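(* Let $K\ge 1$ be a fixed constant. There is a one-pass streaming algorithm in the adjacency list model using a heavy edge oracle (with a threshold chosen by the algorithm) such that, if the oracle is a $K$-noisy oracle, then with probability $2/3$ the algorithm returns a value in $(1\pm\sqrt{K}\cdot\epsilon)T$, and it uses space at most $\tilde{O}\big(\min(\epsilon^{-2}m^{2/3}/T^{1/3},\ K\cdot\epsilon^{-1}m^{1/2})\big)$.
   Context: $G=(V,E)$ is a simple undirected graph with $n$ vertices, $m$ edges and $T$ triangles; $0<\epsilon<1$. Adjacency list model: adjacency lists of vertices arrive contiguously, one vertex at a time (each edge appears twice); the algorithm makes one pass. For an edge $e=xy$, $N_e$ is the number of triangles containing both $x$ and $y$. For a threshold $\rho$, an oracle $O_\rho$ (outputting HEAVY or LIGHT on each queried edge) is $K$-noisy if for every edge $e$, $1-K\cdot\frac{\rho}{N_e}\le \Pr[O_\rho(e)=\textsc{heavy}]\le K\cdot\frac{N_e}{\rho}$. The algorithm is assumed to know a constant-factor approximation of $T$. $\tilde{O}(f)=O(f\cdot\mathrm{polylog}(f))$. *)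

(* Defs.v *)
From HB Require Import structures.
From mathcomp Require Import all_boot all_order all_algebra.
From mathcomp Require Import all_classical all_reals all_analysis.

Set Implicit Arguments.
Unset Strict Implicit.
Unset Printing Implicit Defensive.
Import Order.TTheory GRing.Theory Num.Theory.
Local Open Scope ring_scope.

(* A simple graph on 'I_n is a symmetric irreflexive e : rel 'I_n; its edges  *)
(* and triangles are 2- and 3-element vertex sets.                            *)
Definition edges (n : nat) (e : rel 'I_n) : {set {set 'I_n}} :=
  [set [set p.1; p.2] | p : 'I_n * 'I_n in [pred p | e p.1 p.2]].

Definition triangles (n : nat) (e : rel 'I_n) : {set {set 'I_n}} :=
  [set t : {set 'I_n} | (#|t| == 3%N) &&
     [forall x in t, forall y in t, (x != y) ==> e x y]].

Definition triangles_at (n : nat) (e : rel 'I_n) (f : {set 'I_n}) : nat :=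
  #|[set t in triangles e | f \subset t]|.

(* The token (v, u) says that u occurs in the adjacency list of v. The order  *)
(* of the lists and the order inside each list are arbitrary.                 *)
Definition adjacency_list_stream (n : nat) (e : rel 'I_n)
    (s : seq ('I_n * 'I_n)) : Prop :=
  exists (vs : seq 'I_n) (adj : 'I_n -> seq 'I_n),
    [/\ perm_eq vs (enum 'I_n),
        forall v, perm_eq (adj v) [seq u <- enum 'I_n | e v u]
      & s = flatten [seq [seq (v, u) | u <- adj v] | v <- vs]].

Definition is_pmf (R : realType) (W : finType) (mu : W -> R) : Prop :=
  (forall w, 0 <= mu w) /\ \sum_w mu w = 1.

(* HEAVY is true. An oracle is random, and O f is its answer on the edge f:   *)
(* the same for all queries of f within one run.                              *)
Definition labelling (n : nat) : finType := {ffun {set 'I_n} -> bool}.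

Definition prob_heavy (R : realType) (n : nat) (D : labelling n -> R)
    (f : {set 'I_n}) : R :=
  \sum_(O : labelling n | O f) D O.

(* Nothing is assumed on the dependence between different edges. When N_f = 0 *)
(* the lower bound 1 - K * (rho / N_f) is -oo, hence the guard.               *)
Definition noisy_oracle (R : realType) (n : nat) (e : rel 'I_n) (K rho : R)
    (D : labelling n -> R) : Prop :=
  is_pmf D /\
  forall f, f \in edges e ->
    let N : R := (triangles_at e f)%:R in
    (0 < N -> 1 - K * (rho / N) <= prob_heavy D f) /\
    prob_heavy D f <= K * (N / rho).

(* [step q (v, u) h r] is the memory after the token (v, u) arrives in memory *)
(* state q, h being the oracle's answer on the edge vu and r a coin drawn     *)
(* afresh at each token: past coins are available only if stored in the state. *)
Record oracle_stream_alg (R : realType) (n : nat) := OracleStreamAlg {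
  threshold : R;
  threshold_gt0 : 0 < threshold;
  state : finType;
  coin : finType;
  coin_law : coin -> R;
  coin_law_pmf : is_pmf coin_law;
  init : state;
  step : state -> 'I_n * 'I_n -> bool -> coin -> state;
  output : state -> R }.

Definition run (R : realType) (n : nat) (A : oracle_stream_alg R n)
    (O : labelling n) (s : seq ('I_n * 'I_n)) (r : seq (coin A)) : state A :=
  foldl (fun q (x : ('I_n * 'I_n) * coin A) =>
           step q x.1 (O [set x.1.1; x.1.2]) x.2)
        (init A) (zip s r).

(* The oracle and the coins are independent.                                  *)
Definition prob_output (R : realType) (n : nat) (A : oracle_stream_alg R n)
    (D : labelling n -> R) (s : seq ('I_n * 'I_n)) (good : pred R) : R :=
  \sum_(O : labelling n)
    \sum_(r : (size s).-tuple (coin A) | good (output (run O s r)))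
      D O * \prod_(i < size s) coin_law (tnth r i).

(* log_2 #|state A| bits, counted in words of log_2 (n + 2) bits.             *)
Definition space_words (R : realType) (n : nat) (A : oracle_stream_alg R n) : R :=
  ln (#|state A|%:R : R) / ln (n.+2%:R : R).

(* For T = 0 the first term of the minimum is +oo.                            *)
Definition target_space (R : realType) (K eps : R) (m T : nat) : R :=
  let b := K * eps^-1 * m%:R `^ (2%:R^-1) in
  if T == 0%N then b
  else Num.min (eps ^- 2 * (m%:R `^ (2%:R / 3%:R) / T%:R `^ (3%:R^-1))) b.

(* The shift by 2 only keeps the logarithm away from 0 for small f.           *)
Definition soft_bound (R : realType) (C : R) (d : nat) (f : R) : R :=
  C * (f * ln (2%:R + f) ^+ d).

(* Main.v *)
(** Number the vertices by the order of their lists. Every triangle [a < b < c] is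
charged to one of the two edges [ab], [ac] that are first seen in the list of [a], so
that it is detected whenever that edge has been sampled: the first light one of the
two, if any. Light edges are sampled at rate [p]; as an edge in [N] triangles is light
with probability at most [K rho / N], they contribute [O(K rho T / p)] to the variance.

Heavy edges number [O(K T / rho)] on average. They are either all stored, which gives
the bound [K m^(1/2) / eps], or sampled at a rate [q]. In the latter case an independent
auxiliary sample of heavy edges, of rate [q' = T^(-1/2)], decides at the list of [c]
whether a triangle with [ab] and [ac] heavy is charged to [ac] (no hit: [ac] closes at
most about [T^(1/2)] such triangles) or to [ab] (hit: this happens for at most about
[T^(1/2)] vertices [c]). The variance is then [O(T^(3/2) / q)], independently of [K],
and [q ~ 1 / (K eps^2 T^(1/2))] suffices. With [rho ~ T^(2/3) / m^(1/3)] the space is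
[O(eps^(-2) m^(2/3) / T^(1/3))]. Chebyshev's inequality bounds the error and Markov's
the probability of running out of memory; no logarithmic factor is needed. *)

Require Import Defs.
From HB Require Import structures.
From mathcomp Require Import all_boot all_order all_algebra.
From mathcomp Require Import all_classical all_reals all_analysis.
From mathcomp Require Import fintype finset ring lra zify.
Set Implicit Arguments.
Unset Strict Implicit.
Unset Printing Implicit Defensive.
Import Order.TTheory GRing.Theory Num.Theory.

(** * Finite expectations *)

Local Open Scope ring_scope.

Section Expectation.
Variables (R : realFieldType) (W : finType) (P : W -> R).
Definition expect (F : W -> R) : R := \sum_w P w * F w.

Lemma expectZ a F : expect (fun w => a * F w) = a * expect F.
Proof. by rewrite /expect big_distrr /=; apply: eq_bigr => w _; rewrite mulrCA. Qed.

Lemma eq_expect F G : F =1 G -> expect F = expect G.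
Proof. by move=> FG; apply: eq_bigr => w _; rewrite FG. Qed.

Lemma expectD F G : expect (fun w => F w + G w) = expect F + expect G.
Proof. by rewrite /expect -big_split; apply: eq_bigr => w _; rewrite mulrDr. Qed.

Lemma expect_sum (J : finType) (Q : pred J) (F : J -> W -> R) :
  expect (fun w => \sum_(j | Q j) F j w) = \sum_(j | Q j) expect (F j).
Proof.
rewrite /expect exchange_big /=; apply: eq_bigr => w _.
by rewrite big_distrr.
Qed.

Hypothesis P0 : forall w, 0 <= P w.

Lemma ler_expect F G : (forall w, F w <= G w) -> expect F <= expect G.
Proof. by move=> FG; apply: ler_sum => w _; rewrite ler_wpM2l. Qed.

Hypothesis P1 : \sum_w P w = 1.

Lemma expect_cst a : expect (fun=> a) = a.
Proof. by rewrite /expect -big_distrl /= P1 mul1r. Qed.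

Variables (J : finType) (Q : pred J) (xi : J -> W -> bool) (q : J -> R).
Hypothesis q_gt0 : forall j, Q j -> 0 < q j.
Hypothesis xi1 : forall j, Q j -> expect (fun w => (xi j w)%:R) = q j.
Hypothesis xi2 : forall i j, Q i -> Q j -> i != j ->
  expect (fun w => (xi i w)%:R * (xi j w)%:R) = q i * q j.

(** The centred variables [xi j / q j - 1] are pairwise uncorrelated, so only the diagonal survives;
    there [xi ^ 2 = xi] leaves [1 / q j - 1]. *)
Lemma variance_pairwise (a : J -> R) :
  expect (fun w => (\sum_(j | Q j) a j * ((xi j w)%:R / q j - 1)) ^+ 2) =
  \sum_(j | Q j) a j ^+ 2 * ((q j)^-1 - 1).
Proof.
pose z j w : R := (xi j w)%:R / q j - 1.
have zz i j w : a i * z i w * (a j * z j w) =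
    a i * a j * (((q i)^-1 * (q j)^-1) * ((xi i w)%:R * (xi j w)%:R)
     + (- (q i)^-1 * (xi i w)%:R + (- (q j)^-1 * (xi j w)%:R + 1))).
  by rewrite /z; ring.
rewrite (@eq_expect _ (fun w => \sum_(i | Q i) \sum_(j | Q j)
    a i * z i w * (a j * z j w))); last first.
  move=> w; rewrite expr2 big_distrl /=; apply: eq_bigr => i _.
  by rewrite big_distrr.
rewrite expect_sum; apply: eq_bigr => i Qi.
rewrite expect_sum (bigD1 i) //= [X in _ + X]big1 ?addr0.
  rewrite (eq_expect (zz i i)) expectZ !expectD !expectZ expect_cst.
  rewrite (@eq_expect (fun w => (xi i w)%:R * (xi i w)%:R) (fun w => (xi i w)%:R)).
    by rewrite xi1 // expr2; field; rewrite gt_eqF // q_gt0.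
  by move=> w; case: (xi i w); rewrite ?mulr1 ?mulr0.
move=> j /andP[Qj ij].
rewrite (eq_expect (zz i j)) expectZ !expectD !expectZ expect_cst.
rewrite xi2 // 1?eq_sym // !xi1 //; field.
by rewrite !gt_eqF // q_gt0.
Qed.

(* Chebyshev for the number of hits, which only needs pairwise independence. *)
Lemma prob_no_hit (q0 : R) : (forall j, Q j -> q j = q0) -> 0 < q0 -> (0 < #|Q|)%N ->
  expect (fun w => (~~ [exists j, Q j && xi j w])%:R) <= (q0 * #|Q|%:R)^-1.
Proof.
move=> qE q00 Q0.
have N0 : 0 < #|Q|%:R :> R by rewrite ltr0n.
(* With equal weights [1 / #|Q|] the centred sum is exactly -1 when nothing is hit, so its square
   dominates the indicator of no hit. *)
have := variance_pairwise (fun=> (#|Q|%:R)^-1).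
set F := (X in expect X) => VE.
have le : expect (fun w => (~~ [exists j, Q j && xi j w])%:R) <= expect F.
  apply: ler_expect => w; rewrite /F; case: existsP => /= hit; first by rewrite sqr_ge0.
  rewrite (eq_bigr (fun=> - (#|Q|%:R)^-1)).
    by rewrite sumr_const mulNrn sqrrN -[X in X ^+ 2]mulr_natr mulVf ?gt_eqF // expr1n.
  move=> j Qj; have -> : xi j w = false.
    by apply: negbTE; apply/negP => xj; apply: hit; exists j; rewrite Qj.
  by rewrite mul0r sub0r mulrN1.
apply: le_trans le _; rewrite VE.
rewrite (eq_bigr (fun=> (#|Q|%:R ^-1) ^+ 2 * (q0^-1 - 1))); last by move=> j /qE ->.
rewrite sumr_const -[X in X <= _]mulr_natr invfM.
rewrite (_ : _ * _ * _ = (q0^-1 - 1) * #|Q|%:R^-1); last first.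
  have /negbT := gt_eqF N0; move: (#|Q|%:R) => N Nn0.
  by field; rewrite Nn0 gt_eqF.
by apply: ler_wpM2r; [rewrite invr_ge0 ltW | rewrite gerBl].
Qed.
End Expectation.

(** * Independent coins and product laws *)

Section ProductLaw.
Variables (R : realFieldType) (I C : finType) (mu : C -> R).
Definition prodlaw (w : {ffun I -> C}) : R := \prod_i mu (w i).

Hypothesis mu_pmf : (forall x, 0 <= mu x) /\ \sum_x mu x = 1.

Lemma prodlaw_ge0 w : 0 <= prodlaw w.
Proof. by apply: prodr_ge0 => i _; exact: mu_pmf.1. Qed.

Lemma expect_prodlaw (f : I -> C -> R) :
  expect prodlaw (fun w => \prod_i f i (w i)) = \prod_i expect mu (f i).
Proof.
rewrite /expect bigA_distr_bigA /=; apply: eq_bigr => w _.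
by rewrite big_split.
Qed.

Lemma prodlaw1 : \sum_w prodlaw w = 1.
Proof.
transitivity (expect prodlaw (fun w => \prod_(i : I) 1)).
  by apply: eq_bigr => w _; rewrite big1 // mulr1.
rewrite (expect_prodlaw (fun _ _ => 1)) big1 // => i _.
by rewrite expect_cst // mu_pmf.2.
Qed.

Lemma expect_prodlaw1 i (f : C -> R) :
  expect prodlaw (fun w => f (w i)) = expect mu f.
Proof.
pose F k x := if k == i then f x else 1.
transitivity (expect prodlaw (fun w : {ffun I -> C} => \prod_k F k (w k))).
  apply: eq_expect => w.
  by rewrite /F (bigD1 i) //= eqxx big1 ?mulr1 // => k /negbTE ->.
rewrite expect_prodlaw (bigD1 i) //= {1}/F eqxx big1 ?mulr1 // => k /negbTE ki.
by rewrite /F ki expect_cst // mu_pmf.2.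
Qed.

Lemma expect_prodlaw2 i j (f g : C -> R) : i != j ->
  expect prodlaw (fun w => f (w i) * g (w j)) = expect mu f * expect mu g.
Proof.
move=> ij; have ji : j != i by rewrite eq_sym.
pose F k x := if k == i then f x else if k == j then g x else 1.
transitivity (expect prodlaw (fun w : {ffun I -> C} => \prod_k F k (w k))).
  apply: eq_expect => w.
  rewrite /F (bigD1 i) //= eqxx (bigD1 j) //= eqxx (negbTE ji) big1 ?mulr1 // => k.
  by move=> /andP[/negbTE-> /negbTE->].
rewrite expect_prodlaw (bigD1 i) //= (bigD1 j) //= /F eqxx (negbTE ji) eqxx.
rewrite big1 ?mulr1 // => k /andP[/negbTE-> /negbTE->].
by rewrite expect_cst // mu_pmf.2.
Qed.
End ProductLaw.

(** Fubini for two independent families of coins: the second is frozen while the first is averaged,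
    as is done later with the auxiliary and the sampling coins. *)
Lemma expect_prodlaw_pair (R : realFieldType) (I C1 C2 : finType)
    (mu1 : C1 -> R) (mu2 : C2 -> R) (F : {ffun I -> C1 * C2} -> R) :
  expect (prodlaw (fun x => mu1 x.1 * mu2 x.2)) F =
  expect (prodlaw mu2) (fun w2 => expect (prodlaw mu1)
    (fun w1 => F [ffun i => (w1 i, w2 i)])).
Proof.
rewrite /expect [RHS](eq_bigr (fun w2 => \sum_(w1 : {ffun I -> C1})
  prodlaw mu2 w2 * (prodlaw mu1 w1 * F [ffun i => (w1 i, w2 i)]))); last first.
  by move=> w2 _; rewrite big_distrr.
rewrite exchange_big pair_big /=.
rewrite (reindex (fun p : {ffun I -> C1} * {ffun I -> C2} =>
   [ffun i => (p.1 i, p.2 i)])) /=.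
  apply: eq_bigr => -[w1 w2] _ /=.
  rewrite mulrA /prodlaw [X in X * F _ = _](_ : _ =
    (\prod_i mu2 (w2 i)) * \prod_i mu1 (w1 i)) //.
  by rewrite -big_split /=; apply: eq_bigr => i _; rewrite ffunE /= mulrC.
exists (fun w => ([ffun i => (w i).1], [ffun i => (w i).2])) => [[w1 w2] _|w _] /=.
  by congr pair; apply/ffunP => i; rewrite !ffunE.
by apply/ffunP => i; rewrite !ffunE; case: (w i).
Qed.

Lemma sum_tuple_prodlaw (R : realFieldType) (N : nat) (C : finType) (mu : C -> R)
    (F : N.-tuple C -> R) :
  \sum_r (\prod_(i < N) mu (tnth r i)) * F r =
  expect (prodlaw mu) (fun w : {ffun 'I_N -> C} => F [tuple w i | i < N]).
Proof.
rewrite /expect (reindex (fun w : {ffun 'I_N -> C} => [tuple w i | i < N])) /=.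
  apply: eq_bigr => w _; congr (_ * _).
  by apply: eq_bigr => i _; rewrite tnth_mktuple.
exists (fun t => [ffun i => tnth t i]) => [w _|t _].
  by apply/ffunP => i; rewrite ffunE tnth_mktuple.
by apply: eq_from_tnth => i; rewrite tnth_mktuple ffunE.
Qed.

Local Close Scope ring_scope.

(** * Counting triangles *)

Section GraphCounting.
Variables (n : nat) (e : rel 'I_n).
Hypotheses (e_sym : symmetric e) (e_irr : irreflexive e).

Lemma edge_neq a b : e a b -> a != b.
Proof. by apply: contraTneq => ->; rewrite e_irr. Qed.

Lemma card_pair_le2 (a b : 'I_n) : #|[set a; b]| <= 2.
Proof. by rewrite cards2; case: (_ != _). Qed.

Lemma card_adjacent_le : #|[set x : 'I_n * 'I_n | e x.1 x.2]| <= 4 * #|edges e|.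
Proof.
have sub : [set x : 'I_n * 'I_n | e x.1 x.2] \subset
    \bigcup_(f in edges e) setX f f.
  apply/subsetP => -[a b]; rewrite inE /= => eab.
  apply/bigcupP; exists [set a; b]; last by rewrite in_setX !inE !eqxx orbT.
  by apply/imsetP; exists (a, b).
apply: leq_trans (subset_leq_card sub) _.
apply: (@leq_trans (\sum_(f in edges e) #|setX f f|)).
  elim/big_rec2: _ => [|f m U _ IH]; first by rewrite cards0.
  by apply: leq_trans (leq_card_setU _ _).1 _; rewrite leq_add2l.
rewrite mulnC -sum_nat_const; apply: leq_sum => f /imsetP[[a b] _ ->] /=.
by rewrite cardsX (@leq_mul _ _ 2 2) // card_pair_le2.
Qed.

Lemma triangleP t : reflect (exists a b c,
    [/\ e a b, e a c, e b c & t = [set a; b; c]]) (t \in triangles e).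
Proof.
rewrite inE; apply: (iffP andP) => [[/eqP t3 /forall_inP tri]|].
  have /card_gt0P[a at_] : 0 < #|t| by rewrite t3.
  have t2 : #|t :\ a| = 2 by have := cardsD1 a t; rewrite at_ t3 => -[].
  have /eqP/cards2P[b [c [bc tE]]] := t2.
  have : b \in t :\ a by rewrite tE !inE eqxx.
  have : c \in t :\ a by rewrite tE !inE eqxx orbT.
  rewrite !inE => /andP[ca ct] /andP[ba bt].
  have adj x y : x \in t -> y \in t -> x != y -> e x y.
    by move=> xt yt; apply/implyP; exact: (forall_inP (tri _ xt)).
  exists a, b, c; split; [by apply: adj; rewrite // eq_sym| |exact: adj|].
    by apply: adj; rewrite // eq_sym.
  by rewrite -(setD1K at_) tE setUA.
move=> [a [b [c [ab ac bc ->]]]]; split.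
  have := edge_neq ab; have := edge_neq ac; have := edge_neq bc.
  rewrite -setUA cardsU1 cards2 !inE => -> /negbTE-> /negbTE->.
  by [].
apply/forall_inP => x; rewrite !inE -orbA => xP.
apply/forall_inP => y; rewrite !inE -orbA => yP; apply/implyP.
by case/or3P: xP => /eqP->; case/or3P: yP => /eqP->; rewrite ?eqxx // e_sym.
Qed.

(** A triangle is the union of two of its edges. The bound excludes triangles when there is no edge,
    and keeps [y] away from 0 in [y_ge]. *)
Lemma card_triangles_le : #|triangles e| <= #|edges e| ^ 2.
Proof.
have sub : triangles e \subset
    (fun p : {set 'I_n} * {set 'I_n} => p.1 :|: p.2) @: setX (edges e) (edges e).
  apply/subsetP => t /triangleP[a [b [c [ab ac bc ->]]]].
  apply/imsetP; exists ([set a; b], [set b; c]).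
    by rewrite in_setX; apply/andP; split; apply/imsetP; [exists (a, b)|exists (b, c)].
  by apply/setP => x; rewrite !inE; case: (x == a); case: (x == b); case: (x == c).
apply: leq_trans (subset_leq_card sub) _.
by apply: leq_trans (leq_imset_card _ _) _; rewrite cardsX -mulnn.
Qed.

Lemma card_common_le a b : e a b ->
  #|[set v | e v a && e v b]| <= triangles_at e [set a; b].
Proof.
move=> eab; pose F v := [set a; b; v].
have inj : {in [set v | e v a && e v b] &, injective F}.
  move=> u v; rewrite !inE => /andP[ua ub] /andP[va vb] /setP /(_ u).
  rewrite !inE eqxx orbT (negbTE (edge_neq ua)) (negbTE (edge_neq ub)) /=.
  by move/esym/eqP.
rewrite -(card_in_imset inj); apply: subset_leq_card.
apply/subsetP => t /imsetP[v]; rewrite !inE => /andP[va vb] ->.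
have : F v \in triangles e.
  by apply/triangleP; exists a, b, v; split=> //; rewrite e_sym.
rewrite inE => ->; apply/subsetP => x; rewrite !inE => ->.
by [].
Qed.

Lemma sum_triangles_at_le :
  \sum_(x : 'I_n * 'I_n | e x.1 x.2) triangles_at e [set x.1; x.2] <=
  9 * #|triangles e|.
Proof.
rewrite (eq_bigr (fun x : 'I_n * 'I_n =>
  \sum_(t in triangles e) ([set x.1; x.2] \subset t : nat))); last first.
  move=> x _; rewrite /triangles_at -sum1dep_card big_mkcondr /=.
  by apply: eq_bigr => t _; case: (_ \subset _).
rewrite exchange_big /= mulnC -sum_nat_const; apply: leq_sum => t tT.
have t3 : #|t| = 3 by move: tT; rewrite inE => /andP[/eqP].
have -> : 9 = #|setX t t| by rewrite cardsX t3.
rewrite -big_mkcondr sum1dep_card; apply: subset_leq_card.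
apply/subsetP => -[a b]; rewrite !inE /= => /andP[_ /subsetP st].
by rewrite !st // !inE eqxx ?orbT.
Qed.

(** Positions are asked to differ along edges only: [pos] will be the index in a list of the
    non-isolated vertices, which gives all the others the same value. *)
Variable pos : 'I_n -> nat.
Hypothesis pos_edge : forall a b, e a b -> pos a != pos b.

Definition ordered_triangle a b c := [&& pos a < pos b, pos b < pos c, e a b, e a c & e b c].

Lemma card_ordered_triangle : \sum_a \sum_b \sum_c (ordered_triangle a b c : nat) = #|triangles e|.
Proof.
pose TT := [set x : 'I_n * 'I_n * 'I_n | ordered_triangle x.1.1 x.1.2 x.2].
pose F (x : 'I_n * 'I_n * 'I_n) := [set x.1.1; x.1.2; x.2].
have -> : \sum_a \sum_b \sum_c (ordered_triangle a b c : nat) = #|TT|.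
  rewrite pair_big pair_big /= -sum1dep_card [RHS]big_mkcond /=.
  by apply: eq_bigr => x _; case: (ordered_triangle _ _ _).
have inj : {in TT &, injective F}.
  move=> [[a b] c] [[a' b'] c']; rewrite !inE /= /F /=.
  move=> /and5P[ab bc _ _ _] /and5P[ab' bc' _ _ _] /setP E.
  have in3 x : x \in [set a'; b'; c'] -> x = a \/ x = b \/ x = c.
    by rewrite -E !inE -orbA => /or3P[] /eqP; tauto.
  have ha := in3 a'; have hb := in3 b'; have hc := in3 c'.
  have {}ha := ha ltac:(by rewrite !inE eqxx).
  have {}hb := hb ltac:(by rewrite !inE eqxx orbT).
  have {}hc := hc ltac:(by rewrite !inE eqxx orbT).
  clear E in3; case: hc => [|[]] hc; rewrite hc in bc' |- *;
    case: hb => [|[]] hb; rewrite hb in ab' bc' |- *;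
    try (exfalso; move: ab bc bc'; clear; lia);
    case: ha => [|[]] ha; rewrite ha in ab' |- *; try done;
    exfalso; move: ab bc ab' bc'; clear; lia.
rewrite -(card_in_imset inj); apply: eq_card => t.
apply/imsetP/idP => [[[[a b] c]]|/triangleP[a [b [c [ab ac bc ->]]]]].
  rewrite inE /= => /and5P[_ _ ab ac bc] ->.
  by apply/triangleP; exists a, b, c.
have wit x y z : ordered_triangle x y z -> [set a; b; c] = [set x; y; z] ->
    exists2 x0, x0 \in TT & [set a; b; c] = F x0.
  by move=> xyz E; exists (x, y, z); rewrite ?inE.
have [ba ca cb] : [/\ e b a, e c a & e c b] by split; rewrite e_sym.
have := pos_edge ab; have := pos_edge ac; have := pos_edge bc.
rewrite !neq_ltn => /orP[] pbc /orP[] pac /orP[] pab.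
- by apply: (wit a b c) => //; apply/and5P.
- by apply: (wit b a c); [apply/and5P | apply/setP => x; rewrite !inE; case: (x == a); case: (x == b); case: (x == c)].
- by move: pbc pac pab; clear; lia.
- by apply: (wit b c a); [apply/and5P | apply/setP => x; rewrite !inE; case: (x == a); case: (x == b); case: (x == c)].
- by apply: (wit a c b); [apply/and5P | apply/setP => x; rewrite !inE; case: (x == a); case: (x == b); case: (x == c)].
- by move: pbc pac pab; clear; lia.
- by apply: (wit c a b); [apply/and5P | apply/setP => x; rewrite !inE; case: (x == a); case: (x == b); case: (x == c)].
- by apply: (wit c b a); [apply/and5P | apply/setP => x; rewrite !inE; case: (x == a); case: (x == b); case: (x == c)].
Qed.
End GraphCounting.

(** * Charging triangles to edges *)

Section Charging.
Variables (n : nat) (e : rel 'I_n) (pos : 'I_n -> nat) (hv : rel 'I_n).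
Hypotheses (e_sym : symmetric e) (e_irr : irreflexive e).
Hypothesis pos_edge : forall a b, e a b -> pos a != pos b.
Local Notation tri := (ordered_triangle e pos).
Local Notation T := #|triangles e|.

(* [a, b, c] are in the order of their lists. A triangle goes to [ab] if [ab] is
   light, else to [ac] if [ac] is light; if both are heavy it goes to [ab] when the
   auxiliary sample [eta] hits a heavy edge [ab'] with [ab'c] a triangle
   ([ac] is then likely to lie in many triangles), and to [ac] otherwise. *)
Definition crowded (eta : 'I_n * 'I_n -> bool) a c :=
  [exists b, [&& tri a b c, hv a b & eta (a, b)]].

(** Triangles [a, v, b] with the list of [v] between the two others: [ab] is their second edge, so
    it gets them only if [av] is heavy, and gives them all up when it is itself heavy and
    crowded. *)
Definition charge_before eta a b :=
  if hv a b && crowded eta a b then 0 else \sum_v (tri a v b && hv a v : nat).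

(** Here [ab] is the first edge: if light it takes every triangle, if heavy only those whose second
    edge [av] is heavy and crowded. *)
Definition charge_after eta a b :=
  \sum_v (tri a b v && (hv a b ==> hv a v && crowded eta a v) : nat).

Definition charge eta (x : 'I_n * 'I_n) :=
  charge_before eta x.1 x.2 + charge_after eta x.1 x.2.

(** In a triangle [a, b, v] the conditions for charging [ab] and [av] are complementary, whatever
    [eta] is. *)
Lemma sum_charge eta : \sum_x charge eta x = T.
Proof.
rewrite -(card_ordered_triangle e_sym e_irr pos_edge) -(pair_bigA _ (fun a b => charge eta (a, b))) /=.
apply: eq_bigr => a _; rewrite /charge big_split /=.
have -> : \sum_b charge_before eta a b = \sum_b \sum_v
    ([&& tri a b v, hv a b & ~~ (hv a v && crowded eta a v)] : nat).
  rewrite exchange_big; apply: eq_bigr => b _; rewrite /charge_before.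
  case: ifP => _; first by rewrite big1 // => v _; rewrite !andbF.
  by apply: eq_bigr => v _; rewrite andbT.
rewrite -big_split; apply: eq_bigr => b _; rewrite -big_split.
apply: eq_bigr => v _; case: (tri a b v) => //=.
by case: (hv a b) => //=; case: (_ && _).
Qed.

Lemma charge_out eta x : ~~ (e x.1 x.2 && (pos x.1 < pos x.2)) -> charge eta x = 0.
Proof.
case: x => a b /= nab; rewrite /charge /charge_before /charge_after /=.
rewrite [X in _ + X]big1 ?addn0 => [|v _].
  case: ifP => // _; rewrite big1 // => v _.
  case t: (tri a v b) => //=; case/and5P: t => av vb _ ab _; move: nab.
  by rewrite ab (ltn_trans av vb).
by case t: (tri a b v) => //=; case/and5P: t => ab _ eab _ _; move: nab; rewrite eab ab.
Qed.

(** The list of a third vertex comes either before or after that of [b], so no triangle enters both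
    halves of the charge. *)
Lemma charge_le eta x : charge eta x <= #|[set v | e v x.1 && e v x.2]|.
Proof.
case: x => a b; rewrite /charge /=.
apply: (@leq_trans (\sum_v (tri a v b : nat) + \sum_v (tri a b v : nat))).
  apply: leq_add; last by apply: leq_sum => v _; case: (tri a b v); rewrite ?leq_b1.
  rewrite /charge_before; case: ifP => // _.
  by apply: leq_sum => v _; case: (tri a v b); case: (hv a v).
rewrite -big_split -sum1dep_card [X in _ <= X]big_mkcond /=; apply: leq_sum => v _.
rewrite /ordered_triangle ![e v _]e_sym [e b v]e_sym.
case: (e a v) => /=; rewrite ?andbF //; case: (e v b) => /=; rewrite ?andbF ?andbT //.
by case: (ltngtP (pos v) (pos b)); rewrite ?andbF //=; case: (_ && _) => //; case: (_ && _).
Qed.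

Local Open Scope ring_scope.
Variables (R : realFieldType) (W : finType) (P : W -> R).
Hypotheses (P0 : forall w, 0 <= P w) (P1 : \sum_w P w = 1).
Variables (eta : 'I_n * 'I_n -> W -> bool) (q : R).
Hypothesis q_gt0 : 0 < q.
Hypothesis eta1 : forall x, e x.1 x.2 -> expect P (fun w => (eta x w)%:R) = q.
Hypothesis eta2 : forall x y, e x.1 x.2 -> e y.1 y.2 -> x != y ->
  expect P (fun w => (eta x w)%:R * (eta y w)%:R) = q * q.

Let et w x := eta x w.
(** The number of triangles that [ac] closes over a heavy first edge. It bounds [charge_before], and
    is also the number of chances [eta] has to make [ac] crowded. *)
Let B a c : R := \sum_b (tri a b c && hv a b)%:R.

Let sumB : \sum_a \sum_c B a c <= T%:R.
Proof.
rewrite -(card_ordered_triangle e_sym e_irr pos_edge) natr_sum; apply: ler_sum => a _.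
rewrite exchange_big natr_sum; apply: ler_sum => b _; rewrite natr_sum.
by apply: ler_sum => c _; rewrite ler_nat; case: (tri a b c); rewrite ?leq_b1.
Qed.

Let B_card a c : B a c = #|[pred b | tri a b c && hv a b]|%:R.
Proof.
rewrite -sum1_card natr_sum big_mkcond; apply: eq_bigr => b _.
by rewrite inE; case: (_ && _).
Qed.

Let tri_e a b c : tri a b c -> e a b.
Proof. by case/and5P. Qed.

Lemma expect_not_crowded a c : 0 < B a c ->
  expect P (fun w => (~~ crowded (et w) a c)%:R) <= (q * B a c)^-1.
Proof.
move=> B0; rewrite B_card.
rewrite (@eq_expect _ _ _ _ (fun w => (~~ [exists b, (tri a b c && hv a b)
   && eta (a, b) w])%:R)); last first.
  by move=> w; congr (~~ _)%:R; apply: eq_existsb => b; rewrite andbA.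
apply: (prob_no_hit P0 P1 (q := fun=> q)) => //.
- by move=> b /andP[/tri_e ab _]; exact: (eta1 (x := (a, b))).
- move=> b b' /andP[/tri_e ab _] /andP[/tri_e ab' _] bb'.
  apply: (eta2 (x := (a, b)) (y := (a, b'))) => //.
  by apply: contra bb' => /eqP[->].
- by rewrite B_card ltr0n in B0.
Qed.

(** For a heavy [ac], the square of [B a c] is paid only if [ac] is not crowded, with probability at
    most [1 / (q * B a c)]. What is left, [B a c / q], sums to at most [T / q]. *)
Lemma expect_charge_before :
  expect P (fun w => \sum_x (hv x.1 x.2)%:R * (charge_before (et w) x.1 x.2)%:R ^+ 2)
  <= T%:R / q.
Proof.
rewrite expect_sum.
apply: (@le_trans _ _ (\sum_(x : 'I_n * 'I_n) B x.1 x.2 / q)); last first.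
  rewrite -big_distrl /= ler_wpM2r ?invr_ge0 ?(ltW q_gt0) //.
  by have := sumB; rewrite (pair_bigA _ (fun a c => B a c)).
apply: ler_sum => -[a c] _ /=.
have Bge0 : 0 <= B a c by apply: sumr_ge0 => b _; rewrite ler0n.
have E w : (hv a c)%:R * (charge_before (et w) a c)%:R ^+ 2
    <= B a c ^+ 2 * (~~ crowded (et w) a c)%:R :> R.
  rewrite /charge_before; case: (hv a c) => /=; last first.
    by rewrite mul0r mulr_ge0 ?sqr_ge0.
  case: (crowded _ _ _) => /=; first by rewrite expr0n mulr0 mulr0.
  by rewrite mul1r mulr1 natr_sum.
apply: (le_trans (ler_expect P0 E)); rewrite expectZ.
have [B0|B0] := ltP 0 (B a c); last first.
  by rewrite (@le_anti _ _ (B a c) 0) ?Bge0 ?B0 // expr0n !mul0r.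
apply: (@le_trans _ _ (B a c ^+ 2 * (q * B a c)^-1)).
  by rewrite ler_wpM2l ?sqr_ge0 ?expect_not_crowded.
by rewrite le_eqVlt; apply/orP; left; apply/eqP; field; rewrite !gt_eqF.
Qed.

Lemma expect_crowded a c : expect P (fun w => (crowded (et w) a c)%:R) <= q * B a c.
Proof.
have E w : (crowded (et w) a c)%:R
    <= \sum_(b | tri a b c && hv a b) (eta (a, b) w)%:R :> R.
  case: (boolP (crowded _ _ _)) => [/existsP[b /and3P[t h x]]|_]; last exact: sumr_ge0.
  by rewrite (bigD1 b) ?t ?h //= [eta _ _]x lerDl sumr_ge0.
apply: (le_trans (ler_expect P0 E)).
rewrite expect_sum (eq_bigr (fun=> q)) => [|b /andP[/tri_e ab _]]; last first.
  exact: (eta1 (x := (a, b))).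
by rewrite sumr_const B_card mulr_natr.
Qed.

(** On a heavy edge [charge_after] is at most the number [Z] of crowded pairs. As the charges sum to
    [T], the squares sum to at most [T * Z], and a union bound gives [Z] a mean of at most
    [q * T]. *)
Lemma expect_charge_after :
  expect P (fun w => \sum_x (hv x.1 x.2)%:R * (charge_after (et w) x.1 x.2)%:R ^+ 2)
  <= q * T%:R ^+ 2.
Proof.
pose Z w : R := \sum_a \sum_c (crowded (et w) a c)%:R.
have E w : \sum_x (hv x.1 x.2)%:R * (charge_after (et w) x.1 x.2)%:R ^+ 2
    <= T%:R * Z w :> R.
  apply: (@le_trans _ _ (\sum_x (charge (et w) x)%:R * Z w)); last first.
    by rewrite -big_distrl /= -natr_sum sum_charge.
  apply: ler_sum => -[a b] _ /=.
  case h: (hv a b); last by rewrite mul0r mulr_ge0 // sumr_ge0 // => *; rewrite sumr_ge0.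
  rewrite mul1r expr2 ler_pM //; first by rewrite ler_nat leq_addl.
  rewrite /Z (bigD1 a) //= /charge_after natr_sum h.
  apply: ler_wpDr; first by apply: sumr_ge0 => *; rewrite sumr_ge0.
  apply: ler_sum => v _; rewrite ler_nat /=.
  by case: (crowded _ _ _); rewrite ?andbF //; case: (_ && _).
apply: (le_trans (ler_expect P0 E)); rewrite expectZ expr2 mulrCA ler_wpM2l //.
rewrite /Z expect_sum; apply: (@le_trans _ _ (\sum_a \sum_c q * B a c)).
  by apply: ler_sum => a _; rewrite expect_sum; apply: ler_sum => c _; exact: expect_crowded.
by under eq_bigr do rewrite -big_distrr /=; rewrite -big_distrr /= ler_wpM2l // ltW.
Qed.

(** By [(u + v) ^ 2 <= 2 * (u ^ 2 + v ^ 2)]. The two terms balance at [q = T ^ (-1/2)], where they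
    are of order [T ^ (3/2)]. *)
Lemma expect_charge_heavy :
  expect P (fun w => \sum_x (hv x.1 x.2)%:R * (charge (et w) x)%:R ^+ 2)
  <= 2 * (T%:R / q + q * T%:R ^+ 2).
Proof.
apply: (@le_trans _ _ (2 * (expect P (fun w => \sum_x
    (hv x.1 x.2)%:R * (charge_before (et w) x.1 x.2)%:R ^+ 2) +
  expect P (fun w => \sum_x
    (hv x.1 x.2)%:R * (charge_after (et w) x.1 x.2)%:R ^+ 2)))); last first.
  by rewrite ler_wpM2l // lerD ?expect_charge_before ?expect_charge_after.
rewrite -expectD -expectZ; apply: ler_expect => // w.
rewrite -big_split big_distrr /=; apply: ler_sum => x _.
rewrite -mulrDr [leRHS]mulrCA ler_wpM2l // /charge natrD.
move: (_%:R) (_%:R) => u v; have := sqr_ge0 (u - v); nra.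
Qed.
End Charging.

(** * The memory and its invariant *)

(* A stored token (tail, head).  [closed] says that the list of head came after
   that of tail; [before] and [after] count the triangles charged to the edge whose
   third list came before, resp. after, that of head; the [meets] bits describe the
   list being read, and are reset when it ends. *)
Record item (n : nat) := Item {
  arc : 'I_n * 'I_n;
  heavy : bool;
  sampled : bool;
  auxiliary : bool;
  closed : bool;
  before : 'I_n.+1;
  after : 'I_n.+1;
  meets_tail : bool;
  meets_tail_heavy : bool;
  meets_head : bool }.

Definition item_code n (j : item n) :=
  (arc j, (before j, after j), (heavy j, sampled j, auxiliary j, closed j),
   (meets_tail j, meets_tail_heavy j, meets_head j)).

Definition item_decode n (c : ('I_n * 'I_n) * ('I_n.+1 * 'I_n.+1)
    * (bool * bool * bool * bool) * (bool * bool * bool)) : item n :=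
  let: (x, (k, l), (h, s, a, d), (t, th, u)) := c in Item x h s a d k l t th u.

Lemma item_codeK n : cancel (@item_code n) (@item_decode n).
Proof. by case. Qed.

HB.instance Definition _ n := Finite.copy (item n) (can_type (@item_codeK n)).

Lemma leq_expW k m1 m2 : m1 <= m2 -> m1 ^ k <= m2 ^ k.
Proof. by case: k => // k le12; rewrite leq_exp2r. Qed.

Lemma card_item n : #|{: item n}| <= n.+2 ^ 11.
Proof.
apply: (@leq_trans #|{: ('I_n * 'I_n) * ('I_n.+1 * 'I_n.+1)
    * (bool * bool * bool * bool) * (bool * bool * bool)}|).
  exact: (leq_card _ (can_inj (@item_codeK n))).
rewrite !card_prod !card_ord !card_bool.
have two k : 2 ^ k <= n.+2 ^ k by exact: leq_expW.
(* Two vertices, two counters, four flags and three [meets] bits, a bit being counted as a letter of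
   an alphabet of size [n.+2]: an item takes a constant number of words. *)
rewrite (_ : n.+2 ^ 11 = n.+2 ^ 2 * n.+2 ^ 2 * n.+2 ^ 4 * n.+2 ^ 3); last by rewrite -!expnD.
apply: leq_mul (two 3); apply: leq_mul (two 4).
by apply: leq_mul; rewrite -mulnn leq_mul //; lia.
Qed.

(** * The machine, with unbounded and with bounded memory *)

Section Machine.
Variable n : nat.
Implicit Types (j : item n) (L : seq (item n)).

Definition fresh x h s a : item n := Item x h s a false ord0 ord0 false false false.

Definition touch u h j :=
  Item (arc j) (heavy j) (sampled j) (auxiliary j) (closed j) (before j) (after j)
    (meets_tail j || (u == (arc j).1))
    (meets_tail_heavy j || (u == (arc j).1) && h)
    (meets_head j || (u == (arc j).2)).

(** [inord] falls back to [ord0] above [n]; the counts it will represent never exceed [n]. *)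
Definition bump (k : 'I_n.+1) : 'I_n.+1 := inord k.+1.

(** At the end of the list of [v] this reads [crowded a v] off the memory: [closed] and [meets_head]
    say that the list of the head precedes that of [v] and that the head is adjacent to [v]. *)
Definition aux_hit L a :=
  has (fun j => [&& (arc j).1 == a, auxiliary j, closed j & meets_head j]) L.

(** Acts once the list of [v] has been read, while [L] still carries its [meets] bits. If [v] is the
    head, the item closes, and [before] is cleared when the edge is heavy and crowded. Otherwise
    [before] grows on an open item and [after] on a closed one. *)
Definition close_list v L j :=
  let hit := aux_hit L (arc j).1 in
  Item (arc j) (heavy j) (sampled j) (auxiliary j) (closed j || ((arc j).2 == v))
    (if (arc j).2 == v then (if heavy j && hit then ord0 else before j)
     else if [&& ~~ closed j, meets_tail_heavy j & meets_head j]
       then bump (before j) else before j)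
    (if [&& closed j, meets_head j &
          if heavy j then meets_tail_heavy j && hit else meets_tail j]
     then bump (after j) else after j)
    false false false.

(** The vertex being read, the items of earlier lists, and those created in the current list, kept
    apart so that its tokens leave them untouched. *)
Definition memory := (option 'I_n * seq (item n) * seq (item n))%type.
Implicit Types m : memory.

Definition finish m : seq (item n) :=
  (if m.1.1 is Some v then [seq close_list v m.1.2 j | j <- m.1.2] else m.1.2) ++ m.2.

(** The end of a list shows only when a token of another list arrives, so the pending [finish] runs
    then, and once more at readout for the last list. *)
Definition open_list v m : memory :=
  if m.1.1 == Some v then m else (Some v, finish m, [::]).

Definition mstep m (x : 'I_n * 'I_n) h s a : memory :=
  let m' := open_list x.1 m in
  (Some x.1, [seq touch x.2 h j | j <- m'.1.2], m'.2 ++ nseq (s || a) (fresh x h s a)).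

Definition stored m := size m.1.2 + size m.2.

Lemma size_finish m : size (finish m) = stored m.
Proof. by rewrite /finish size_cat; case: (m.1.1) => [v|]; rewrite ?size_map. Qed.

Lemma stored_mstep m x h s a : stored (mstep m x h s a) = stored m + (s || a).
Proof.
rewrite /mstep /stored /= size_map size_cat size_nseq addnA; congr (_ + _).
rewrite /open_list; case: ifP => // _ /=.
by rewrite size_finish addn0.
Qed.

Definition bmemory M := (option 'I_n * M.-bseq (item n) * M.-bseq (item n))%type.

(* [insub_bseq] returns the empty sequence on overflow. *)
Definition bound M m : bmemory M := (m.1.1, insub_bseq M m.1.2, insub_bseq M m.2).
Definition unbound M (m : bmemory M) : memory := (m.1.1, m.1.2 : seq _, m.2 : seq _).

Lemma boundK M m : stored m <= M -> unbound (bound M m) = m.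
Proof.
case: m => -[v L] L'; rewrite /stored /= => le.
have ins (s : seq (item n)) : size s <= M -> insub_bseq M s = s :> seq _.
  by move=> sM; rewrite /insub_bseq val_insubd sM.
by rewrite /unbound /= !ins //; lia.
Qed.

Lemma card_bmemory M : #|{: bmemory M}| <= n.+2 ^ (24 * M).+1.
Proof.
have cb : #|{: M.-bseq (item n)}| <= n.+2 ^ (12 * M).
  rewrite card_bseq expnM.
  apply: (@leq_trans ((n.+2 ^ 11).+1 ^ M)); last first.
    apply: leq_expW; rewrite (expnS _ 11).
    by have : 0 < n.+2 ^ 11; [rewrite expn_gt0 | move: (n.+2 ^ 11) => k; nia].
  (* Inserting binomial coefficients, all at least 1, bounds the number of sequences of length at
     most [M] by [(n.+2 ^ 11).+1 ^ M]. *)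
  apply: (@leq_trans (\sum_(i < M.+1) 'C(M, i) * (n.+2 ^ 11) ^ i)).
    apply: leq_sum => i _; rewrite -[X in X <= _]mul1n leq_mul ?bin_gt0 //.
      by rewrite -ltnS.
    exact: leq_expW (card_item n).
  rewrite -[X in X ^ M]add1n expnDn; apply: leq_sum => i _.
  by rewrite exp1n mul1n.
rewrite !card_prod card_option card_ord expnS.
rewrite (_ : 24 * M = 12 * M + 12 * M); last by lia.
by rewrite expnD mulnA; apply: leq_mul => //; apply: leq_mul.
Qed.

Variables (h s a : 'I_n * 'I_n -> bool).
Definition mfold m xs := foldl (fun m x => mstep m x (h x) (s x) (a x)) m xs.
Definition bfold M (b : bmemory M) xs :=
  foldl (fun (b : bmemory M) x => bound M (mstep (unbound b) x (h x) (s x) (a x))) b xs.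

Lemma stored_mfold m xs : stored (mfold m xs) = stored m + count (fun x => s x || a x) xs.
Proof.
elim/last_ind: xs => [|xs x IH]; first by rewrite addn0.
by rewrite /mfold foldl_rcons stored_mstep -/(mfold m xs) IH -cats1 count_cat /= addn0 addnA.
Qed.

(** The number of stored items never decreases, so if the final memory fits, no intermediate one
    overflowed. *)
Lemma bfoldE M m xs : stored (mfold m xs) <= M ->
  bfold (bound M m) xs = bound M (mfold m xs).
Proof.
elim/last_ind: xs => // xs x IH; rewrite /mfold /bfold !foldl_rcons.
rewrite -/(mfold m xs) -/(bfold _ xs) stored_mstep => le.
have le' : stored (mfold m xs) <= M by apply: leq_trans le; exact: leq_addr.
by rewrite IH // boundK.
Qed.

Lemma mfold_touch v L N us : mfold (Some v, L, N) [seq (v, u) | u <- us] =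
  (Some v,
   [seq foldl (fun j u => touch u (h (v, u)) j) j us | j <- L],
   N ++ [seq fresh x (h x) (s x) (a x) | x <- [seq (v, u) | u <- us] & s x || a x]).
Proof.
elim: us L N => [|u us IH] L N /=; first by rewrite cats0 map_id.
rewrite -[LHS]/(mfold (mstep (Some v, L, N) (v, u) (h (v, u)) (s (v, u)) (a (v, u)))
  [seq (v, u0) | u0 <- us]).
rewrite [mstep _ _ _ _ _]/mstep /open_list /= eqxx /= IH.
rewrite -map_comp -catA; congr (_, _, _ ++ _).
by case: (s (v, u) || a (v, u)).
Qed.

Lemma foldl_touch v us j : foldl (fun j u => touch u (h (v, u)) j) j us =
  Item (arc j) (heavy j) (sampled j) (auxiliary j) (closed j) (before j) (after j)
    (meets_tail j || ((arc j).1 \in us))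
    (meets_tail_heavy j || ((arc j).1 \in us) && h (v, (arc j).1))
    (meets_head j || ((arc j).2 \in us)).
Proof.
elim: us j => [|u us IH] j /=; first by rewrite !orbF; case: j.
rewrite IH /= !inE !(eq_sym _ u) -!orbA; congr Item.
by case: (u =P (arc j).1) => //= ->; case: (h _); rewrite ?andbF ?orbT ?orbF.
Qed.

Lemma mfold_list v us m : us != [::] -> m.1.1 != Some v ->
  mfold m [seq (v, u) | u <- us] =
  (Some v, [seq foldl (fun j u => touch u (h (v, u)) j) j us | j <- finish m],
   [seq fresh x (h x) (s x) (a x) | x <- [seq (v, u) | u <- us] & s x || a x]).
Proof.
case: us => // u us _ mv.
have -> : mfold m [seq (v, u0) | u0 <- u :: us] =
    mfold (Some v, finish m, [::]) [seq (v, u0) | u0 <- u :: us].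
  by rewrite /mfold /= /mstep /open_list /= (negbTE mv) eqxx.
by rewrite mfold_touch.
Qed.
End Machine.

(** * The invariant after each adjacency list *)

Section Invariant.
Variables (n : nat) (e : rel 'I_n) (vs : seq 'I_n) (adj : 'I_n -> seq 'I_n).
Hypotheses (e_sym : symmetric e) (e_irr : irreflexive e).
Hypotheses (vs_uniq : uniq vs) (adj_mem : forall v u, (u \in adj v) = e v u).
Hypothesis adj_uniq : forall v, uniq (adj v).
Hypothesis adj_n0 : forall v, v \in vs -> adj v != [::].
Hypothesis vs_edge : forall a b, e a b -> a \in vs.

Variables (h s r : 'I_n * 'I_n -> bool).
Hypothesis h_sym : forall a b, h (a, b) = h (b, a).

Let pos v := index v vs.
Let hv a b := h (a, b).
Let x_aux x := h x && r x.
Local Notation crowded := (crowded e pos hv r).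

Definition toks vs1 := flatten [seq [seq (v, u) | u <- adj v] | v <- vs1].

(** The [closed] bit of an arc after the lists [vs1]. An arc whose head came first never closes, so
    that an edge is read out only from its earlier end. *)
Definition passed (vs1 : seq 'I_n) (x : 'I_n * 'I_n) := (x.2 \in vs1) && (pos x.1 < pos x.2).

Definition before_pred (x : 'I_n * 'I_n) v :=
  [&& pos x.1 < pos v, ~~ ((pos x.1 < pos x.2) && (pos x.2 < pos v)),
      e v x.1, h (v, x.1) & e v x.2].

Definition after_pred (x : 'I_n * 'I_n) v :=
  [&& pos x.1 < pos x.2, pos x.2 < pos v, e v x.2 &
      if h x then [&& e v x.1, h (v, x.1) & crowded x.1 v] else e v x.1].

(** The invariant: what the item of the token [x] holds once the lists [vs1] are finished. *)
Definition summary vs1 x : item n :=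
  Item x (h x) (s x) (x_aux x) (passed vs1 x)
    (inord (if [&& passed vs1 x, h x & crowded x.1 x.2] then 0
            else count (before_pred x) vs1))
    (inord (count (after_pred x) vs1)) false false false.

Lemma mem_toks vs1 x : (x \in toks vs1) = (x.1 \in vs1) && e x.1 x.2.
Proof.
case: x => a b; apply/flatten_mapP/andP => [[v vv1 /mapP[u]]|[/= a1 ab]].
  by rewrite adj_mem => vu [-> ->].
by exists a => //; apply/mapP; exists b; rewrite ?adj_mem.
Qed.

Lemma bump_inord k : k <= n -> bump (inord k : 'I_n.+1) = inord k.+1.
Proof. by move=> kn; rewrite /bump inordK. Qed.

Section OneList.
Variables (vs1 : seq 'I_n) (v : 'I_n) (vs2 : seq 'I_n).
Hypothesis vsE : vs = vs1 ++ v :: vs2.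

Let v_vs1 : v \notin vs1.
Proof.
by have := vs_uniq; rewrite vsE cat_uniq => /and3P[_ /norP[]].
Qed.

Let pos_v : pos v = size vs1.
Proof. by rewrite /pos vsE index_cat (negbTE v_vs1) /= eqxx addn0. Qed.

Let mem_vs1 b : (b \in vs1) = (pos b < pos v).
Proof.
rewrite pos_v /pos vsE index_cat; case: ifP => [b1|_]; first by rewrite index_mem.
by rewrite ltnNge leq_addr.
Qed.

Let size_vs1 : size vs1 <= n.
Proof.
have := max_card (mem vs1); rewrite card_ord (card_uniqP _) //.
by have := vs_uniq; rewrite vsE cat_uniq => /and3P[].
Qed.

Let count_rcons (P : pred 'I_n) : count P (rcons vs1 v) = count P vs1 + P v.
Proof. by rewrite -cats1 count_cat /= addn0. Qed.

Let count_le (P : pred 'I_n) : count P vs1 <= n.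
Proof. exact: leq_trans (count_size _ _) size_vs1. Qed.

Lemma summary_new u : e v u ->
  summary (rcons vs1 v) (v, u) = fresh (v, u) (h (v, u)) (s (v, u)) (x_aux (v, u)).
Proof.
move=> vu; rewrite /summary /fresh.
have np : passed (rcons vs1 v) (v, u) = false.
  rewrite /passed /= mem_rcons inE mem_vs1; apply/negP => /andP[/orP[/eqP->|]]; lia.
have z (P : pred 'I_n) : (forall w, P w -> pos v < pos w) -> count P (rcons vs1 v) = 0.
  move=> Pv; apply/eqP; rewrite -leqn0 -ltnS ltnS leqNgt -has_count; apply/hasPn => w.
  rewrite mem_rcons inE mem_vs1 => vw; apply/negP => /Pv; case/orP: vw => [/eqP->|]; lia.
have zb : count (before_pred (v, u)) (rcons vs1 v) = 0 by apply: z => w /and5P[].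
have za : count (after_pred (v, u)) (rcons vs1 v) = 0.
  by apply: z => w /and4P[vu' uw _ _]; exact: ltn_trans vu' uw.
by rewrite np zb za /=; congr Item; apply: val_inj; rewrite /= inordK.
Qed.

Let old := [seq foldl (fun j u => touch u (h (v, u)) j) j (adj v)
   | j <- [seq summary vs1 x | x <- toks vs1 & s x || x_aux x]].

(** Every heavy arc selected by [r] is stored, so the memory holds all possible witnesses of
    [crowded a v], and the current list tells which heads are adjacent to [v]. *)
Lemma aux_hit_crowded a : e a v -> aux_hit old a = crowded a v.
Proof.
move=> av; rewrite /aux_hit /old !has_map; apply/hasP/existsP.
  move=> [[a' b]]; rewrite mem_filter mem_toks /= foldl_touch /= adj_mem /passed /=.
  move=> /andP[_ /andP[a1 ab]] /and4P[/eqP aE /andP[hab rab] /andP[b1 pab] vb]; subst a'.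
  exists b; rewrite rab andbT /hv hab andbT /ordered_triangle pab -mem_vs1 b1 ab.
  by rewrite av e_sym vb.
move=> [b /and3P[/and5P[pab pbv ab _ bv] hab rab]].
exists (a, b); rewrite ?mem_filter ?mem_toks /= ?foldl_touch /= /x_aux.
  by rewrite -/(hv a b) hab rab orbT ab mem_vs1 (ltn_trans pab).
by rewrite eqxx -/(hv a b) hab rab adj_mem e_sym bv /passed /= mem_vs1 pbv pab.
Qed.

Lemma summary_old x : x \in toks vs1 ->
  close_list v old (foldl (fun j u => touch u (h (v, u)) j) (summary vs1 x) (adj v)) =
  summary (rcons vs1 v) x.
Proof.
case: x => a b; rewrite mem_toks /= => /andP[a1 ab].
have pav : pos a < pos v by rewrite -mem_vs1.
have b_vs : b \in vs by apply: (vs_edge (b := a)); rewrite e_sym.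
rewrite foldl_touch /close_list /= !adj_mem.
have pE : passed (rcons vs1 v) (a, b) = passed vs1 (a, b) || (b == v).
  rewrite /passed /= mem_rcons inE; case: eqP => [->|_]; last by rewrite orbF.
  by rewrite pav orbT.
have beE : before_pred (a, b) v = [&& ~~ passed vs1 (a, b), e v a && hv v a & e v b].
  by rewrite /before_pred /passed /= pav mem_vs1 [(pos b < pos v) && _]andbC -andbA.
have afE : after_pred (a, b) v = [&& passed vs1 (a, b), e v b &
    if h (a, b) then (e v a && hv v a) && aux_hit old a else e v a].
  rewrite /after_pred /passed /= mem_vs1 -!andbA [RHS]andbCA; do 3 congr andb.
  case: (h (a, b)) => //; case va: (e v a) => //=; rewrite aux_hit_crowded //.
  by rewrite e_sym.
rewrite /summary pE !count_rcons; congr Item; last first.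
  rewrite -afE; case: (after_pred _ v); last by rewrite addn0.
  by rewrite addn1 bump_inord.
rewrite -[h (v, a)]/(hv v a) -beE.
(* When the list of the head itself ends, no triangle is counted, and the crowded test, now
   available, decides whether [before] is cleared. Afterwards [before] is frozen. *)
case: (b =P v) => [bv|/eqP bv].
  subst b; have -> : before_pred (a, v) v = false by rewrite beE e_irr !andbF.
  have -> : passed vs1 (a, v) = false by rewrite /passed /= (negbTE v_vs1).
  rewrite addn0 aux_hit_crowded //=; case: (h (a, v)) => //=.
  by case: (crowded a v) => //; apply: val_inj; rewrite /= inordK.
rewrite orbF; case: (boolP [&& passed _ _, _ & _]) => [/andP[p _]|_].
  by rewrite beE p.
by case: (before_pred _ v); rewrite ?addn0 // addn1 bump_inord.
Qed.
End OneList.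

Definition idle : memory n := (None, [::], [::]).

(** Induction over the lists. The first conjunct says that the next list belongs to a different
    vertex, so that its first token triggers the pending [finish]. *)
Lemma finish_mfold vs1 vs2 : vs = vs1 ++ vs2 ->
  let m := mfold h s x_aux idle (toks vs1) in
  (if m.1.1 is Some v then v \in vs1 else true) /\
  finish m = [seq summary vs1 x | x <- toks vs1 & s x || x_aux x].
Proof.
elim/last_ind: vs1 vs2 => [|vs1 v IH] vs2 vsE //=.
rewrite cat_rcons in vsE; have [mv1 mE] := IH _ vsE.
have toksE : toks (rcons vs1 v) = toks vs1 ++ [seq (v, u) | u <- adj v].
  by rewrite /toks map_rcons flatten_rcons.
have v_vs1 : v \notin vs1.
  by have := vs_uniq; rewrite vsE cat_uniq => /and3P[_ /norP[]].
have v_vs : v \in vs by rewrite vsE mem_cat inE eqxx orbT.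
rewrite toksE /mfold foldl_cat -/(mfold h s x_aux idle (toks vs1)).
set m := mfold h s x_aux idle (toks vs1) in mv1 mE *.
rewrite -/(mfold h s x_aux m _) mfold_list ?adj_n0 //; last first.
  by case: m.1.1 mv1 => // w w1; apply: contraNneq v_vs1 => -[<-].
split; first by rewrite /= mem_rcons inE eqxx.
rewrite mE /finish /= filter_cat map_cat -map_comp; congr (_ ++ _).
  rewrite -map_comp; apply/eq_in_map => x; rewrite mem_filter => /andP[_ x1] /=.
  exact (summary_old vsE x1).
apply/eq_in_map => x; rewrite mem_filter => /andP[_ /mapP[u vu ->]].
by rewrite (summary_new vsE) // -adj_mem.
Qed.

Lemma pos_edge a b : e a b -> pos a != pos b.
Proof.
move=> ab; apply: contraTneq ab => pab.
apply/negP => ab; have : a = b.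
  have ba : e b a by rewrite e_sym.
  by rewrite -(nth_index a (vs_edge ab)) -/(pos a) pab nth_index // (vs_edge ba).
by move=> abE; rewrite abE e_irr in ab.
Qed.

Let count_vs (P : pred 'I_n) : (forall v, P v -> v \in vs) ->
  (inord (count P vs) : 'I_n.+1) = \sum_v (P v : nat) :> nat.
Proof.
move=> Pvs; rewrite inordK; last first.
  rewrite ltnS (leq_trans (count_size _ _)) // -[X in _ <= X]card_ord.
  by rewrite -(card_uniqP vs_uniq) max_card.
rewrite -sum1_count big_mkcond big_uniq //= big_mkcond /=; apply: eq_bigr => v _.
by case: ifPn => [_|/negP nv]; case Pv: (P v) => //; case: nv; exact: Pvs.
Qed.

Lemma summary_charge x : e x.1 x.2 -> pos x.1 < pos x.2 ->
  before (summary vs x) + after (summary vs x) = charge e pos hv r x.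
Proof.
case: x => a b /= ab pab; rewrite /charge /=; congr (_ + _).
  have -> : passed vs (a, b) = true.
    by rewrite /passed /= pab (vs_edge (a := b) (b := a)) // e_sym.
  rewrite /= /charge_before -/(hv a b); case: ifP => _; first by rewrite inordK.
  rewrite count_vs => [|v /and5P[_ _ va _ _]]; last exact: vs_edge va.
  apply: eq_bigr => v _; congr nat_of_bool; rewrite /before_pred /ordered_triangle /= pab ab /=.
  rewrite -leqNgt [pos v <= pos b]leq_eqVlt (e_sym a v) -/(hv v a) [hv v a]h_sym.
  case vb: (e v b); rewrite ?andbF //= (negbTE (pos_edge vb)) /=.
  by rewrite !andbT -!andbA.
rewrite count_vs => [|v /and4P[_ _ vb _]]; last exact: vs_edge vb.
apply: eq_bigr => v _; congr nat_of_bool; rewrite /after_pred /ordered_triangle /= pab ab /=.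
rewrite (e_sym a v) (e_sym b v) -/(hv v a) [hv v a]h_sym -/(hv a b) -/(hv a v).
case: (hv a b) => /=; last by rewrite !andbT andbA andbAC -andbA.
by case: (e v a); case: (e v b); rewrite ?andbF ?andbT //= -andbA.
Qed.

Lemma toks_uniq : uniq (toks vs).
Proof.
apply: allpairs_uniq_dep => // -[v u] [v' u'] _ _ /= [vE uE].
by subst v' u'.
Qed.

Local Open Scope ring_scope.
(** The readout is a Horvitz-Thompson sum: each sampled charge is divided by its sampling rate. *)
Lemma estimate_charge (R : realFieldType) (rate : bool -> R) :
  \sum_(j <- finish (mfold h s x_aux idle (toks vs)) | sampled j && closed j)
    (before j + after j)%:R / rate (heavy j) =
  \sum_(x | e x.1 x.2 && (pos x.1 < pos x.2)%N)
    (charge e pos hv r x)%:R * ((s x)%:R / rate (h x)).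
Proof.
have [_ ->] := finish_mfold (esym (cats0 vs)).
rewrite big_map big_filter_cond big_mkcond big_uniq ?toks_uniq //= [LHS]big_mkcond.
rewrite [RHS]big_mkcond /=; apply: eq_bigr => x _; rewrite mem_toks.
have [ex|] := boolP (e x.1 x.2); last by rewrite andbF.
have pE : passed vs x = (pos x.1 < pos x.2)%N.
  by rewrite /passed (vs_edge (a := x.2) (b := x.1)) // e_sym.
rewrite (vs_edge ex) /=.
case: (ltnP (pos x.1) (pos x.2)) => [p|p]; last first.
  by rewrite pE ltnNge p !andbF.
rewrite -(summary_charge ex p) /= pE p andbT.
by case: (s x); rewrite /= ?andbF ?mul1r ?mul0r ?mulr0.
Qed.
End Invariant.

(** * The algorithm *)

Local Open Scope ring_scope.

Definition bern (R : realFieldType) (p : R) (b : bool) : R := if b then p else 1 - p.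

Lemma bern_pmf (R : realFieldType) (p : R) : 0 <= p <= 1 ->
  (forall b, 0 <= bern p b) /\ \sum_b bern p b = 1.
Proof.
move=> /andP[p0 p1]; split=> [[]|]; rewrite /bern ?subr_ge0 //.
by rewrite big_bool /= addrC subrK.
Qed.

Lemma pair_pmf (R : realFieldType) (C1 C2 : finType) (mu1 : C1 -> R) (mu2 : C2 -> R) :
  (forall x, 0 <= mu1 x) /\ \sum_x mu1 x = 1 ->
  (forall x, 0 <= mu2 x) /\ \sum_x mu2 x = 1 ->
  (forall x : C1 * C2, 0 <= mu1 x.1 * mu2 x.2) /\ \sum_x mu1 x.1 * mu2 x.2 = 1.
Proof.
move=> [p1 s1] [p2 s2]; split=> [x|]; first by rewrite mulr_ge0.
rewrite -(pair_bigA _ (fun x y => mu1 x * mu2 y)) /= -[RHS]s1.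
by apply: eq_bigr => x _; rewrite -big_distrr /= s2 mulr1.
Qed.

(** The law of a coin may not depend on the oracle, so both coins are tossed at every token and the
    answer selects one. *)
Definition coin_choice (h : bool) (y : bool * bool) := if h then y.2 else y.1.

Lemma expect_coin_choice (R : realFieldType) (p q : R) (h : bool) :
  expect (fun y : bool * bool => bern p y.1 * bern q y.2)
    (fun y => (coin_choice h y)%:R) = if h then q else p.
Proof.
rewrite /expect.
rewrite -(pair_bigA _ (fun x y => bern p x * bern q y * (coin_choice h (x, y))%:R)) /=.
rewrite !big_bool /= /bern /coin_choice; case: h => /=; ring.
Qed.

Lemma foldl_map_in (S : eqType) (S' B : Type) (k : S -> S') (f : B -> S' -> B)
    (g : B -> S -> B) (t : seq S) b :
  (forall b x, x \in t -> f b (k x) = g b x) -> foldl f b [seq k x | x <- t] = foldl g b t.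
Proof.
elim: t b => //= x t IH b fg; rewrite fg ?mem_head // IH // => b' y yt.
by rewrite fg // inE yt orbT.
Qed.

(** Tokens are distinct, so coins indexed by time become coins attached to arcs. *)
Lemma zip_index (S C : eqType) (c0 : C) (t : seq S) (r : seq C) :
  uniq t -> size r = size t -> zip t r = [seq (x, nth c0 r (index x t)) | x <- t].
Proof.
move=> ut rt; case: t ut rt => [|x0 t] ut rt; first by case: r rt.
apply: (@eq_from_nth _ (x0, c0)); first by rewrite size_zip size_map rt minnn.
move=> i; rewrite size_zip rt minnn => it.
by rewrite nth_zip ?rt // (nth_map x0) // index_uniq.
Qed.

Section Algorithm.
Variables (R : realType) (n M : nat) (p q q' rho : R).
Hypotheses (p01 : 0 < p <= 1) (q01 : 0 < q <= 1) (q'01 : 0 < q' <= 1) (rho0 : 0 < rho).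

Let muS (y : bool * bool) : R := bern p y.1 * bern q y.2.
Let muA : bool -> R := bern q'.
Let w01 (x : R) : 0 < x <= 1 -> 0 <= x <= 1.
Proof. by move=> /andP[/ltW -> ->]. Qed.

Let muS_pmf : (forall x, 0 <= muS x) /\ \sum_x muS x = 1.
Proof. exact: pair_pmf (bern_pmf (w01 p01)) (bern_pmf (w01 q01)). Qed.
Let muA_pmf : (forall x, 0 <= muA x) /\ \sum_x muA x = 1.
Proof. exact: bern_pmf (w01 q'01). Qed.

Let mu (x : (bool * bool) * bool) : R := muS x.1 * muA x.2.

Lemma alg_coin_pmf : is_pmf mu.
Proof. exact: pair_pmf muS_pmf muA_pmf. Qed.

Definition rate (h : bool) := if h then q else p.

Definition readout (b : bmemory n M) : R :=
  \sum_(j <- finish (unbound b) | sampled j && closed j)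
    (before j + after j)%:R / rate (heavy j).

Definition alg : oracle_stream_alg R n :=
  OracleStreamAlg rho0 alg_coin_pmf (bound M (idle n))
    (fun b x h c => bound M (mstep (unbound b) x h (coin_choice h c.1) (h && c.2)))
    readout.

Variables (e : rel 'I_n) (vs : seq 'I_n) (adj : 'I_n -> seq 'I_n).
Hypotheses (e_sym : symmetric e) (e_irr : irreflexive e).
Hypotheses (vs_uniq : uniq vs) (adj_mem : forall v u, (u \in adj v) = e v u).
Hypothesis adj_uniq : forall v, uniq (adj v).
Hypothesis adj_n0 : forall v, v \in vs -> adj v != [::].
Hypothesis vs_edge : forall a b, e a b -> a \in vs.
Local Notation s := (toks adj vs).
Local Notation pos := (fun v => index v vs).
Local Notation T := #|triangles e|.
Local Notation N := (size s).

Let s_uniq : uniq s. Proof. exact: toks_uniq. Qed.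

Let mem_s x : (x \in s) = e x.1 x.2.
Proof.
rewrite (mem_toks adj_mem); case: (boolP (e x.1 x.2)); rewrite ?andbF // andbT.
by move=> ex; rewrite (vs_edge ex).
Qed.

Let pos_edge' a b : e a b -> pos a != pos b.
Proof. exact: (pos_edge e_sym e_irr vs_edge). Qed.

(** * Mean load and variance for a fixed labelling *)

Section FixedOracle.
Variable O : labelling n.
Let h (x : 'I_n * 'I_n) : bool := O [set x.1; x.2].
Let hv (a b : 'I_n) : bool := h (a, b).

Let h_sym a b : h (a, b) = h (b, a).
Proof. by rewrite /h /= setUC. Qed.

Definition coin_at (C : finType) (c0 : C) (w : {ffun 'I_N -> C}) (x : 'I_n * 'I_n) :=
  nth c0 [tuple w i | i < N] (index x s).

Lemma coin_atE (C : finType) (c0 : C) w x (xs : (index x s < N)%N) :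
  @coin_at C c0 w x = w (Ordinal xs).
Proof. exact: (nth_mktuple _ _ (Ordinal xs)). Qed.

Let index_s x : e x.1 x.2 -> (index x s < N)%N.
Proof. by rewrite index_mem mem_s. Qed.

Lemma expect_coin_at (C : finType) (c0 : C) (nu : C -> R) (f : C -> R) x :
  (forall x, 0 <= nu x) /\ \sum_x nu x = 1 -> e x.1 x.2 ->
  expect (prodlaw nu) (fun w => f (coin_at c0 w x)) = expect nu f.
Proof.
move=> nu_pmf ex; rewrite -(expect_prodlaw1 nu_pmf (Ordinal (index_s ex))).
by apply: eq_expect => w; rewrite (coin_atE _ _ (index_s ex)).
Qed.

Lemma expect_coin_at2 (C : finType) (c0 : C) (nu : C -> R) (f g : C -> R) x y :
  (forall x, 0 <= nu x) /\ \sum_x nu x = 1 -> e x.1 x.2 -> e y.1 y.2 -> x != y ->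
  expect (prodlaw nu) (fun w => f (coin_at c0 w x) * g (coin_at c0 w y)) =
  expect nu f * expect nu g.
Proof.
move=> nu_pmf ex ey xy.
rewrite -(@expect_prodlaw2 _ _ _ nu nu_pmf (Ordinal (index_s ex)) (Ordinal (index_s ey))).
  by apply: eq_expect => w; rewrite (coin_atE _ _ (index_s ex)) (coin_atE _ _ (index_s ey)).
apply: contra xy => /eqP[xyE]; apply/eqP.
by rewrite -(nth_index x (s := s) (x := x)) ?mem_s // xyE nth_index // mem_s.
Qed.

Let xi (wS : {ffun 'I_N -> bool * bool}) x := coin_choice (h x) (coin_at (false, false) wS x).
Let eta (wA : {ffun 'I_N -> bool}) x : bool := coin_at false wA x.
Let coins (wS : {ffun 'I_N -> bool * bool}) (wA : {ffun 'I_N -> bool}) : N.-tuple ((bool * bool) * bool) :=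
  [tuple [ffun i => (wS i, wA i)] i | i < N].

Lemma run_mfold wS wA :
  run O s (coins wS wA : seq (coin alg)) =
  bfold h (xi wS) (fun x => h x && eta wA x) (bound M (idle n)) s :> state alg.
Proof.
rewrite /run (@zip_index _ _ ((false, false), false)) ?size_tuple //.
apply: foldl_map_in => b x /=.
rewrite mem_s => /index_s xs.
have -> : nth (false, false, false) (coins wS wA) (index x s) =
    (coin_at (false, false) wS x, coin_at false wA x).
  by rewrite !(coin_atE _ _ xs) (nth_mktuple _ _ (Ordinal xs)) ffunE.
by [].
Qed.

Let estimate wS wA : R := \sum_(x | e x.1 x.2 && (pos x.1 < pos x.2)%N)
    (charge e pos hv (eta wA) x)%:R * ((xi wS x)%:R / rate (h x)).
Let load wS wA := count (fun x => xi wS x || (h x && eta wA x)) s.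

Lemma output_estimate wS wA : (load wS wA <= M)%N ->
  output (run O s (coins wS wA : seq (coin alg)) : state alg) = estimate wS wA.
Proof.
move=> le; rewrite run_mfold /= /readout.
have st : (stored (mfold h (xi wS) (fun x => h x && eta wA x) (idle n) s) <= M)%N.
  by rewrite stored_mfold.
rewrite bfoldE // boundK //.
exact: (estimate_charge e_sym e_irr vs_uniq adj_mem adj_uniq adj_n0 vs_edge
  (xi wS) (eta wA) h_sym rate).
Qed.

Let Q (x : 'I_n * 'I_n) := e x.1 x.2 && (pos x.1 < pos x.2)%N.

(** The charges sum to [T] for every outcome of the auxiliary coins; once these are frozen, the
    error is a centred sum in the sampling coins. *)
Lemma estimate_dev wS wA : estimate wS wA - T%:R =
  \sum_(x | Q x) (charge e pos hv (eta wA) x)%:R * ((xi wS x)%:R / rate (h x) - 1).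
Proof.
have -> : T%:R = \sum_(x | Q x) (charge e pos hv (eta wA) x)%:R :> R.
  rewrite -(sum_charge hv e_sym e_irr pos_edge' (eta wA)) natr_sum [RHS]big_mkcond /=.
  by apply: eq_bigr => x _; case: ifPn => // /charge_out ->.
by rewrite /estimate -sumrB; apply: eq_bigr => x _; rewrite mulrBr mulr1.
Qed.

Let rate0 b : 0 < rate b.
Proof. by rewrite /rate; case: b; [case/andP: q01|case/andP: p01]. Qed.

Let xi1 x : e x.1 x.2 -> expect (prodlaw muS) (fun w => (xi w x)%:R) = rate (h x).
Proof.
move=> ex; rewrite (expect_coin_at _ (fun y => (coin_choice (h x) y)%:R) muS_pmf ex).
by rewrite expect_coin_choice.
Qed.

Let xi2 x y : e x.1 x.2 -> e y.1 y.2 -> x != y ->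
  expect (prodlaw muS) (fun w => (xi w x)%:R * (xi w y)%:R) = rate (h x) * rate (h y).
Proof.
move=> ex ey xy; rewrite (expect_coin_at2 _ (fun z => (coin_choice (h x) z)%:R)
  (fun z => (coin_choice (h y) z)%:R) muS_pmf ex ey xy).
by rewrite !expect_coin_choice.
Qed.

Let expect_id : expect muA (fun b : bool => b%:R) = q'.
Proof. by rewrite /expect big_bool /= /muA /bern mulr1 mulr0 addr0. Qed.

Let eta1 x : e x.1 x.2 -> expect (prodlaw muA) (fun w => (eta w x)%:R) = q'.
Proof. by move=> ex; rewrite (expect_coin_at _ (fun b : bool => b%:R) muA_pmf ex) expect_id. Qed.

Let eta2 x y : e x.1 x.2 -> e y.1 y.2 -> x != y ->
  expect (prodlaw muA) (fun w => (eta w x)%:R * (eta w y)%:R) = q' * q'.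
Proof.
move=> ex ey xy.
by rewrite (expect_coin_at2 _ (fun b : bool => b%:R) (fun b : bool => b%:R) muA_pmf ex ey xy) expect_id.
Qed.

Let PS0 := prodlaw_ge0 (I := 'I_N) muS_pmf.
Let PA0 := prodlaw_ge0 (I := 'I_N) muA_pmf.
Let PS1 := prodlaw1 'I_N muS_pmf.
Let PA1 := prodlaw1 'I_N muA_pmf.
Let E (F : {ffun 'I_N -> bool * bool} -> {ffun 'I_N -> bool} -> R) : R :=
  expect (prodlaw muA) (fun wA => expect (prodlaw muS) (fun wS => F wS wA)).
Let Nt (x : 'I_n * 'I_n) : R := (triangles_at e [set x.1; x.2])%:R.

Lemma expect_load : E (fun wS wA => (load wS wA)%:R) <=
  \sum_(x | e x.1 x.2) (p + (h x)%:R * (q + q')).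
Proof.
have load_le wS wA : (load wS wA)%:R <=
    \sum_(x | e x.1 x.2) ((xi wS x)%:R + (h x)%:R * (eta wA x)%:R) :> R.
  rewrite /load -sum1_count big_mkcond /= big_uniq //= natr_sum (eq_bigl _ _ mem_s).
  apply: ler_sum => x _.
  by case: (xi wS x); case: (h x); case: (eta wA x); rewrite /= ?mulr0 ?mulr1 ?addr0 ?add0r ?lerDl //.
apply: (@le_trans _ _ (E (fun wS wA =>
    \sum_(x | e x.1 x.2) ((xi wS x)%:R + (h x)%:R * (eta wA x)%:R)))).
  by apply: ler_expect => // wA; apply: ler_expect.
rewrite /E (@eq_expect _ _ _ _ (fun wA =>
    \sum_(x | e x.1 x.2) (rate (h x) + (h x)%:R * (eta wA x)%:R))); last first.
  move=> wA; rewrite expect_sum; apply: eq_bigr => x ex.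
  by rewrite expectD xi1 // expect_cst.
rewrite expect_sum; apply: ler_sum => x ex.
rewrite expectD expect_cst // expectZ eta1 // /rate.
have /andP[p0 _] := p01; case: (h x); rewrite ?mul1r ?mul0r //.
by rewrite addrA lerD2r lerDr ltW.
Qed.

(** With the auxiliary coins frozen, [variance_pairwise] applies. A light charge is at most the
    number of triangles on the edge; the heavy ones are then averaged by [expect_charge_heavy]. *)
Lemma expect_dev : E (fun wS wA => (estimate wS wA - T%:R) ^+ 2) <=
  (p^-1 - 1) * (\sum_(x | e x.1 x.2) (~~ h x)%:R * Nt x ^+ 2) +
  (q^-1 - 1) * (2 * (T%:R / q' + q' * T%:R ^+ 2)).
Proof.
have inv1 x : 0 < x <= 1 -> 0 <= x^-1 - 1 :> R.
  by move=> /andP[x0 x1]; rewrite subr_ge0 invf_ge1.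
have var wA : expect (prodlaw muS) (fun wS => (estimate wS wA - T%:R) ^+ 2) <=
  (p^-1 - 1) * (\sum_(x | e x.1 x.2) (~~ h x)%:R * Nt x ^+ 2) +
  (q^-1 - 1) * \sum_x (hv x.1 x.2)%:R * (charge e pos hv (eta wA) x)%:R ^+ 2.
  rewrite (@eq_expect _ _ _ _ _ (fun wS => congr1 (fun z => z ^+ 2) (estimate_dev wS wA))).
  rewrite (variance_pairwise PS1 (xi := fun x w => xi w x) (q := fun x => rate (h x))).
  - rewrite big_mkcond !big_distrr [X in _ <= X + _]big_mkcond -big_split /=.
    apply: ler_sum => x _; rewrite /Q; case: ifPn => [/andP[ex _]|_]; last first.
      rewrite addr_ge0 //; last by rewrite !mulr_ge0 ?inv1 ?sqr_ge0.
      by case: ifP => // _; rewrite !mulr_ge0 ?inv1 ?sqr_ge0.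
    rewrite ex [hv _ _](_ : _ = h x); last by rewrite /hv -surjective_pairing.
    rewrite /rate; case: (h x) => /=.
      by rewrite mul0r mulr0 add0r mul1r mulrC.
    rewrite mul0r mulr0 addr0 mul1r mulrC ler_wpM2l ?inv1 //.
    rewrite -natrX -natrX ler_nat leq_exp2r //.
    case: x ex => a b ex; apply: leq_trans (charge_le _ _ _ _ _) _ => //.
    exact: card_common_le.
  - by [].
  - by move=> x /andP[ex _]; exact: xi1.
  - by move=> x y /andP[ex _] /andP[ey _]; exact: xi2.
apply: le_trans (ler_expect PA0 var) _.
rewrite expectD expect_cst // expectZ lerD2l ler_wpM2l ?inv1 //.
apply: (expect_charge_heavy hv e_sym e_irr pos_edge' PA0 PA1 (eta := fun x w => eta w x)).
- by case/andP: q'01.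
- exact: eta1.
- exact: eta2.
Qed.

Variable delta : R.
Hypothesis delta0 : 0 < delta.

(** A bad output needs a load above [M] or a deviation above [delta], and each makes a term of one
    nonnegative sum at least 1: Markov and Chebyshev in a single domination. *)
Lemma prob_bad_oracle :
  \sum_(r : N.-tuple (coin alg) | ~~ (`|output (run O s r : state alg) - T%:R| <= delta))
     \prod_(i < N) coin_law (tnth r i) <=
  (\sum_(x | e x.1 x.2) (p + (h x)%:R * (q + q'))) / M.+1%:R +
  ((p^-1 - 1) * (\sum_(x | e x.1 x.2) (~~ h x)%:R * Nt x ^+ 2) +
   (q^-1 - 1) * (2 * (T%:R / q' + q' * T%:R ^+ 2))) / delta ^+ 2.
Proof.
pose bad (r : N.-tuple (coin alg)) := ~~ (`|output (run O s r : state alg) - T%:R| <= delta).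
rewrite big_mkcond /= (eq_bigr (fun r : N.-tuple (coin alg) =>
  (\prod_(i < N) mu (tnth r i)) * (bad r)%:R)); last first.
  by move=> r _; rewrite /bad; case: (~~ _); rewrite ?mulr1 ?mulr0.
rewrite sum_tuple_prodlaw expect_prodlaw_pair.
apply: (@le_trans _ _ (E (fun wS wA => (M.+1%:R)^-1 * (load wS wA)%:R +
    (delta ^+ 2)^-1 * (estimate wS wA - T%:R) ^+ 2))).
  apply: ler_expect => // wA; apply: ler_expect => // wS.
  have d2 : 0 < delta ^+ 2 by rewrite exprn_gt0.
  have [lM|lM] := leqP (load wS wA) M; last first.
    apply: (@le_trans _ _ 1); first by rewrite lern1 leq_b1.
    rewrite -[leLHS]addr0 lerD //; last by rewrite mulr_ge0 ?sqr_ge0 // invr_ge0 ltW.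
    by rewrite mulrC ler_pdivlMr ?ltr0n // mul1r ler_nat.
  have := output_estimate lM; rewrite /bad -/(coins wS wA) => ->.
  case: (lerP `|estimate wS wA - T%:R| delta) => /= [_|bad_dev].
    by rewrite mulr0n addr_ge0 // mulr_ge0 ?sqr_ge0 ?invr_ge0 ?ler0n // ltW.
  rewrite mulr1n; apply: ler_wpDl; first by rewrite mulr_ge0 ?invr_ge0.
  rewrite mulrC ler_pdivlMr // mul1r -[leRHS]real_normK ?num_real //.
  by rewrite lerXn2r ?nnegrE // ltW.
rewrite /E (@eq_expect _ _ _ _ (fun wA =>
   (M.+1%:R)^-1 * expect (prodlaw muS) (fun wS => (load wS wA)%:R) +
    (delta ^+ 2)^-1 * expect (prodlaw muS) (fun wS => (estimate wS wA - T%:R) ^+ 2)));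
  last by move=> wA; rewrite expectD !expectZ.
rewrite expectD !expectZ; apply: lerD.
  by rewrite mulrC ler_wpM2r ?invr_ge0 ?expect_load.
by rewrite mulrC ler_wpM2r ?invr_ge0 ?sqr_ge0 ?expect_dev.
Qed.
End FixedOracle.

(** * Averaging over the noisy oracle *)

Variables (D : labelling n -> R) (K delta : R).
Hypotheses (noisy : noisy_oracle e K rho D) (K0 : 0 <= K) (delta0 : 0 < delta).

Let D0 := noisy.1.1.
Let D1 := noisy.1.2.
Let Nt (x : 'I_n * 'I_n) : R := (triangles_at e [set x.1; x.2])%:R.

Let edge_x x : e x.1 x.2 -> [set x.1; x.2] \in edges e.
Proof. by move=> ex; apply/imsetP; exists x. Qed.

Let heavyE f : expect D (fun O : labelling n => (O f)%:R) = prob_heavy D f.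
Proof.
rewrite /prob_heavy /expect [RHS]big_mkcond; apply: eq_bigr => O _.
by case: (O f); rewrite ?mulr1 ?mulr0.
Qed.

Let sumN : \sum_(x | e x.1 x.2) Nt x <= 9 * T%:R.
Proof. by rewrite /Nt -natr_sum -natrM ler_nat sum_triangles_at_le. Qed.

Let expect_heavy x : e x.1 x.2 ->
  expect D (fun O : labelling n => (O [set x.1; x.2])%:R) <= K / rho * Nt x.
Proof.
by move=> ex; rewrite heavyE (le_trans (noisy.2 _ (edge_x ex)).2) // mulrAC mulrA.
Qed.

(** An edge in [N] triangles is light with probability at most [K * rho / N], which brings [N ^ 2]
    down to [K * rho * N]. *)
Let expect_light x : e x.1 x.2 ->
  expect D (fun O : labelling n => (~~ O [set x.1; x.2])%:R) * Nt x ^+ 2 <= K * rho * Nt x.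
Proof.
move=> ex; have [N0|N0] := ltP 0 (Nt x); last first.
  have -> : Nt x = 0 by apply/le_anti; rewrite N0 ler0n.
  by rewrite expr0n !mulr0.
have -> : expect D (fun O : labelling n => (~~ O [set x.1; x.2])%:R) =
    1 - prob_heavy D [set x.1; x.2].
  apply/eqP; rewrite eq_sym subr_eq -heavyE -expectD; apply/eqP; rewrite -[LHS](expect_cst D1).
  by apply: eq_expect => O; case: (O _); rewrite /= ?addr0 ?add0r.
have := (noisy.2 _ (edge_x ex)).1 N0; rewrite -/(Nt x) => low.
apply: (@le_trans _ _ (K * (rho / Nt x) * Nt x ^+ 2)).
  by rewrite ler_wpM2r ?sqr_ge0 //; lra.
rewrite le_eqVlt; apply/orP; left; apply/eqP; field.
by rewrite gt_eqF.
Qed.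

(* The expected load and the expected variance, with 4 and 9 the number of ordered
   pairs of vertices of an edge and of a triangle (repetitions allowed). *)
Definition overflow_bound : R :=
  4 * #|edges e|%:R * p + 9 * (K / rho) * T%:R * (q + q').
Definition variance_bound : R :=
  (p^-1 - 1) * (9 * (K * rho) * T%:R) + (q^-1 - 1) * (2 * (T%:R / q' + q' * T%:R ^+ 2)).

(** The bound for a fixed labelling is affine in the indicators of heavy edges, so its average
    involves only the marginals of the oracle. *)
Lemma prob_output_ge :
  1 - (overflow_bound / M.+1%:R + variance_bound / delta ^+ 2) <=
  prob_output alg D s (fun y => `|y - T%:R| <= delta).
Proof.
pose good (O : labelling n) (r : N.-tuple (coin alg)) :=
  `|output (run O s r : state alg) - T%:R| <= delta.
have tot : \sum_(r : N.-tuple (coin alg)) \prod_(i < N) coin_law (tnth r i) = 1 :> R.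
  rewrite (eq_bigr (fun r : N.-tuple (coin alg) =>
    (\prod_(i < N) mu (tnth r i)) * 1)); last by move=> r _; rewrite mulr1.
  by rewrite sum_tuple_prodlaw expect_cst // (prodlaw1 _ alg_coin_pmf).
have goodE O : \sum_(r : N.-tuple (coin alg) | good O r)
      D O * \prod_(i < N) coin_law (tnth r i) =
    D O * (1 - \sum_(r : N.-tuple (coin alg) | ~~ good O r) \prod_(i < N) coin_law (tnth r i)).
  rewrite -big_distrr /=; congr (_ * _).
  by apply/eqP; rewrite eq_sym subr_eq; apply/eqP; rewrite -[LHS]tot (bigID (good O)).
rewrite /prob_output (eq_bigr _ (fun O _ => goodE O)).
pose hit (x : 'I_n * 'I_n) (O : labelling n) : R := (O [set x.1; x.2])%:R.
pose miss (x : 'I_n * 'I_n) (O : labelling n) : R := (~~ O [set x.1; x.2])%:R.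
pose L (O : labelling n) : R := \sum_(x | e x.1 x.2) (p + hit x O * (q + q')).
pose V (O : labelling n) : R := \sum_(x | e x.1 x.2) miss x O * Nt x ^+ 2.
pose V2 : R := (q^-1 - 1) * (2 * (T%:R / q' + q' * T%:R ^+ 2)).
apply: (@le_trans _ _ (expect D (fun O => 1 + (- (M.+1%:R)^-1 * L O +
    (- (delta ^+ 2)^-1) * ((p^-1 - 1) * V O + V2))))); last first.
  apply: ler_expect => // O; rewrite lerD2l lerNr opprD !mulNr !opprK.
  rewrite ![_^-1 * _]mulrC; exact: prob_bad_oracle.
rewrite !(expectD, expectZ, expect_cst D1) lerD2l !mulNr -opprD lerN2.
have [p0 p1] := andP p01; have [q0 q1] := andP q01; have [q'0 q'1] := andP q'01.
have qq : 0 <= q + q' by rewrite addr_ge0 // ltW.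
rewrite ![_^-1 * _]mulrC; apply: lerD.
  rewrite ler_wpM2r ?invr_ge0 // /L expect_sum /overflow_bound.
  apply: (@le_trans _ _ (\sum_(x | e x.1 x.2) (p + K / rho * Nt x * (q + q')))).
    apply: ler_sum => x ex; rewrite expectD expect_cst // lerD2l.
    rewrite (@eq_expect _ _ _ _ (fun O => (q + q') * hit x O)) => [|O]; last exact: mulrC.
    by rewrite expectZ mulrC ler_wpM2r // expect_heavy.
  rewrite big_split /= -big_distrl -big_distrr /=; apply: lerD.
    rewrite sumr_const -[leLHS]mulr_natl ler_wpM2r ?(ltW p0) //.
    rewrite -natrM ler_nat; apply: leq_trans (card_adjacent_le e).
    by rewrite cardsE.
  rewrite ler_wpM2r // (_ : 9 * (K / rho) * T%:R = K / rho * (9 * T%:R)); last by ring.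
  rewrite ler_wpM2l //.
  by rewrite divr_ge0 // ltW.
rewrite ler_wpM2r ?invr_ge0 ?sqr_ge0 // /variance_bound lerD2r.
rewrite ler_wpM2l ?subr_ge0 ?invf_ge1 // /V expect_sum.
apply: (@le_trans _ _ (\sum_(x | e x.1 x.2) K * rho * Nt x)).
  apply: ler_sum => x ex; rewrite (@eq_expect _ _ _ _ (fun O => Nt x ^+ 2 * miss x O)).
    by rewrite expectZ mulrC expect_light.
  by move=> O; exact: mulrC.
rewrite -big_distrr /= (_ : 9 * (K * rho) * T%:R = K * rho * (9 * T%:R)); last by ring.
by rewrite ler_wpM2l // mulr_ge0 // ltW.
Qed.
End Algorithm.

(** * Choice of the parameters *)

(* Empty adjacency lists leave no trace in the stream, so they are dropped. *)
Lemma stream_toks n (e : rel 'I_n) s : adjacency_list_stream e s ->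
  exists (vs : seq 'I_n) (adj : 'I_n -> seq 'I_n),
  [/\ uniq vs, (forall v u, (u \in adj v) = e v u), (forall v, uniq (adj v)),
      (forall v, v \in vs -> adj v != [::]) /\ (forall a b, e a b -> a \in vs)
    & s = toks adj vs].
Proof.
move=> [vs0 [adj [pvs padj ->]]].
have adjm v u : (u \in adj v) = e v u.
  by rewrite (perm_mem (padj v)) mem_filter mem_enum andbT.
exists [seq v <- vs0 | adj v != [::]], adj; split => //.
- by rewrite filter_uniq // (perm_uniq pvs) enum_uniq.
- by move=> v; rewrite (perm_uniq (padj v)) filter_uniq // enum_uniq.
- split=> [v|a b ab]; first by rewrite mem_filter => /andP[].
  rewrite mem_filter (perm_mem pvs) mem_enum andbT.
  by apply: contraTneq ab; rewrite -adjm => ->.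
- rewrite /toks; elim: vs0 {pvs} => //= v vs0 ->.
  by case: (eqVneq (adj v) [::]) => [->|].
Qed.

Lemma space_words_alg (R : realType) n M (p q q' rho : R) p01 q01 q'01 rho0 :
  space_words (@alg R n M p q q' rho p01 q01 q'01 rho0) <= 24 * M%:R + 1.
Proof.
rewrite /space_words.
have n2 : 0 < ln (n.+2%:R : R) by rewrite ln_gt0 // ltr1n.
have c0 : (0 < #|{: bmemory n M}|)%N by apply/card_gt0P; exists (bound M (idle n)).
rewrite ler_pdivrMr //=.
apply: (@le_trans _ _ (ln ((n.+2%:R : R) ^+ (24 * M).+1))).
  rewrite ler_ln ?posrE ?ltr0n ?exprn_gt0 ?ltr0n // -natrX ler_nat.
  exact: card_bmemory.
by rewrite lnXn ?ltr0n // -[leLHS]mulr_natl -[(24 * M).+1]addn1 natrD natrM.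
Qed.

Section Tuning.
Variable R : realType.

Lemma min1_itv (t : R) : 0 < t -> 0 < Num.min 1 t <= 1.
Proof. by move=> t0; rewrite lt_min ltr01 t0 /= ge_min lexx. Qed.

(** At rate 1 the variance factor vanishes, so capping a rate at 1 keeps the bound of the uncapped
    rate. *)
Lemma min1_inv (t : R) : 0 < t -> (Num.min 1 t)^-1 - 1 <= t^-1.
Proof.
move=> t0; rewrite minEle; case: ifP => _; first by rewrite invr1 subrr invr_ge0 ltW.
by rewrite gerBl.
Qed.

Variables (n : nat) (e : rel 'I_n) (c K eps X a : R).
Hypotheses (e_sym : symmetric e) (e_irr : irreflexive e).
Hypotheses (c1 : 1 <= c) (K1 : 1 <= K) (eps0 : 0 < eps) (Keps : K * eps ^+ 2 <= 1).
(** [78 = 6 * (9 + 4)]: 9 and 4 are the constants of the light and the heavy variance, which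
    together may cost a failure probability of 1/6; [c ^ 2] is the loss from [X] to [T]. *)
Hypothesis aE : a = 78 * c ^+ 2.
Local Notation m := (#|edges e|%:R : R).
Local Notation T := (#|triangles e|%:R : R).
Hypotheses (X1 : 1 <= X) (TX : T <= X) (XT : X <= c ^+ 2 * T).

Let X0 : 0 < X. Proof. exact: lt_le_trans X1. Qed.
Let c0 : 0 < c. Proof. exact: lt_le_trans c1. Qed.
Let K0 : 0 < K. Proof. exact: lt_le_trans K1. Qed.
Let a0 : 0 < a. Proof. by rewrite aE mulr_gt0 // exprn_gt0. Qed.
Let sX : 0 < Num.sqrt X. Proof. by rewrite sqrtr_gt0. Qed.
Let sXX : Num.sqrt X * Num.sqrt X = X. Proof. by rewrite -expr2 sqr_sqrtr // ltW. Qed.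
Let T0 : 0 < T.
Proof.
rewrite ltr0n lt0n; apply/eqP => Tz; move: XT; rewrite Tz mulr0.
by rewrite leNgt X0.
Qed.

Definition p_of rho := Num.min 1 (a * rho / (eps ^+ 2 * X)).

Lemma variance_bound_le q rho : 0 < rho -> 0 < q <= 1 ->
  q^-1 - 1 <= K * eps ^+ 2 * Num.sqrt X / a ->
  variance_bound (p_of rho) q (Num.sqrt X)^-1 rho e K / (Num.sqrt K * eps * T) ^+ 2
  <= 6^-1.
Proof.
move=> rho0 /andP[q0 q1] hq.
have e2 : 0 < eps ^+ 2 by rewrite exprn_gt0.
have d2 : (Num.sqrt K * eps * T) ^+ 2 = K * eps ^+ 2 * T ^+ 2.
  by rewrite !exprMn sqr_sqrtr // ltW.
have d20 : 0 < K * eps ^+ 2 * T ^+ 2 by rewrite !mulr_gt0 // exprn_gt0.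
rewrite d2 ler_pdivrMr // /variance_bound invrK.
have hp : (p_of rho)^-1 - 1 <= eps ^+ 2 * X / (a * rho).
  by rewrite -[leRHS]invf_div min1_inv // divr_gt0 // mulr_gt0.
have XTa : X / a <= T / 78.
  rewrite ler_pdivrMr // aE (_ : T / 78 * (78 * c ^+ 2) = c ^+ 2 * T) //; by field.
have V1 : ((p_of rho)^-1 - 1) * (9 * (K * rho) * T) <= 9 / 78 * (K * eps ^+ 2 * T ^+ 2).
  apply: (@le_trans _ _ (eps ^+ 2 * X / (a * rho) * (9 * (K * rho) * T))).
    by rewrite ler_wpM2r // !mulr_ge0 // ltW.
  rewrite (_ : _ * _ = 9 * K * eps ^+ 2 * T * (X / a)); last by field; rewrite !gt_eqF.
  rewrite (_ : 9 / 78 * _ = 9 * K * eps ^+ 2 * T * (T / 78)); last by field.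
  by rewrite ler_wpM2l // !mulr_ge0 // ltW.
have V2 : T * Num.sqrt X + (Num.sqrt X)^-1 * T ^+ 2 <= 2 * (T * Num.sqrt X).
  rewrite (_ : 2 * (T * Num.sqrt X) = T * Num.sqrt X + T * Num.sqrt X); last by ring.
  rewrite lerD2l mulrC ler_pdivrMr // -mulrA sXX expr2.
  by rewrite ler_wpM2l // ltW.
have V3 : (q^-1 - 1) * (2 * (T * Num.sqrt X + (Num.sqrt X)^-1 * T ^+ 2))
    <= 4 / 78 * (K * eps ^+ 2 * T ^+ 2).
  apply: (@le_trans _ _ (K * eps ^+ 2 * Num.sqrt X / a * (2 * (2 * (T * Num.sqrt X))))).
    by apply: ler_pM; [rewrite subr_ge0 invf_ge1| |exact: hq|rewrite ler_wpM2l].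
  rewrite (_ : _ * _ = 4 * K * eps ^+ 2 * T * ((Num.sqrt X * Num.sqrt X) / a)); last first.
    by field; rewrite gt_eqF.
  rewrite sXX (_ : 4 / 78 * _ = 4 * K * eps ^+ 2 * T * (T / 78)); last by field.
  by rewrite ler_wpM2l // !mulr_ge0 // ltW.
apply: (le_trans (lerD V1 V3)).
by rewrite -mulrDl ler_wpM2r ?(ltW d20) //; lra.
Qed.

Lemma alg_correct W q rho (rho0 : 0 < rho) (q01 : 0 < q <= 1)
    (p01 : 0 < p_of rho <= 1) (q'01 : 0 < (Num.sqrt X)^-1 <= 1) s D :
  q^-1 - 1 <= K * eps ^+ 2 * Num.sqrt X / a -> 0 <= W ->
  overflow_bound (p_of rho) q (Num.sqrt X)^-1 rho e K <= W / 6 ->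
  adjacency_list_stream e s -> noisy_oracle e K rho D ->
  2 / 3 <= prob_output (alg n (Num.truncn W) p01 q01 q'01 rho0) D s
    (fun y => `|y - T| <= Num.sqrt K * eps * T).
Proof.
move=> hq W0 ov /stream_toks[vs [adj [vsu am au [an ve] ->]]] noisy.
have d0 : 0 < Num.sqrt K * eps * T by rewrite !mulr_gt0 // sqrtr_gt0.
apply: le_trans (prob_output_ge (Num.truncn W) p01 q01 q'01 rho0 e_sym e_irr
  vsu am au an ve noisy (ltW K0) d0).
have := variance_bound_le rho0 q01 hq.
(* An overflow needs [(Num.truncn W).+1] items, which exceeds [W], so rounding the capacity down
   costs nothing in Markov's inequality. Overflow and deviation each get 1/6. *)
have /andP[_ /ltW WM] := truncn_itv W0.
have : overflow_bound (p_of rho) q (Num.sqrt X)^-1 rho e K / (Num.truncn W).+1%:R <= 6^-1.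
  rewrite ler_pdivrMr ?ltr0n // (le_trans ov) // mulrC ler_wpM2l //.
move=> h1 h2; apply: (@le_trans _ _ (1 - (6^-1 + 6^-1))); first by lra.
by rewrite lerD2l lerN2 lerD.
Qed.

(** The cube root of [m ^ 2 / X] and the square root of [m]: the two competing space bounds are
    [y / eps ^ 2] and [K * sm / eps]. *)
Variables (y sm : R).
Hypotheses (y0 : 0 < y) (y3 : y ^+ 3 = m ^+ 2 / X) (sm0 : 0 < sm) (smm : sm * sm = m).

Let m0 : 0 < m. Proof. by rewrite -smm mulr_gt0. Qed.

Let Tm2 : T <= m ^+ 2.
Proof. by rewrite -natrX ler_nat card_triangles_le. Qed.

Lemma y_ge : 1 <= c * y.
Proof.
have : 1 <= (c * y) ^+ 3.
  rewrite exprMn y3 mulrA ler_pdivlMr // mul1r.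
  apply: (le_trans XT); apply: (@le_trans _ _ (c ^+ 2 * m ^+ 2)).
    by rewrite ler_wpM2l // sqr_ge0.
  by rewrite ler_wpM2r ?sqr_ge0 // [leRHS]exprS ler_peMl // sqr_ge0.
by rewrite expr_ge1 // mulr_ge0 // ltW.
Qed.

(** After squaring this reads [y ^ 3 <= c ^ 2 * y ^ 4], which follows from [y_ge]. *)
Lemma m_sqrtX_le : m / Num.sqrt X <= c * y ^+ 2.
Proof.
have cy : 0 <= c * y ^+ 2 by rewrite mulr_ge0 // ?sqr_ge0 // ltW.
rewrite -(@ler_pXn2r _ 2) ?nnegrE // ?divr_ge0 ?(ltW m0) ?(ltW sX) //.
rewrite exprMn exprVn sqr_sqrtr ?(ltW X0) // -y3.
apply: (@le_trans _ _ (c * y * y ^+ 3)).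
  by rewrite ler_peMl ?y_ge // exprn_ge0 // ltW.
rewrite (_ : (c * y ^+ 2) ^+ 2 = c * (c * y * y ^+ 3)); last by ring.
by rewrite ler_peMl // !mulr_ge0 // ?exprn_ge0 // ltW.
Qed.

Definition load_factor : R := 4 * a + 9 * (a + 1) * c.

Let mp_le rho : 0 < rho -> 4 * m * p_of rho <= 4 * a * (m * rho / (eps ^+ 2 * X)).
Proof.
move=> rho0; apply: (@le_trans _ _ (4 * m * (a * rho / (eps ^+ 2 * X)))).
  by rewrite ler_wpM2l ?mulr_ge0 // /p_of ge_min lexx orbT.
by rewrite le_eqVlt; apply/orP; left; apply/eqP; ring.
Qed.

(** The threshold [X * y / m] makes the light sample of order [y / eps ^ 2]. By [K * eps ^ 2 <= 1]
    the auxiliary rate is absorbed in the bound on [q], whose factor [1 / K] cancels the [K] in the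
    number of heavy edges. *)
Lemma overflow_sampled q : 0 < q -> q <= a / (K * eps ^+ 2 * Num.sqrt X) ->
  overflow_bound (p_of (X * y / m)) q (Num.sqrt X)^-1 (X * y / m) e K
  <= load_factor * (y / eps ^+ 2).
Proof.
move=> q0 hq; have rho0 : 0 < X * y / m by rewrite divr_gt0 // mulr_gt0.
have e2 : 0 < eps ^+ 2 by rewrite exprn_gt0.
rewrite /overflow_bound /load_factor [leRHS]mulrDl; apply: lerD.
  apply: (le_trans (mp_le rho0)); rewrite le_eqVlt; apply/orP; left; apply/eqP.
  by congr (_ * _); field; rewrite !gt_eqF.
have qq : q + (Num.sqrt X)^-1 <= (a + 1) / (K * eps ^+ 2 * Num.sqrt X).
  rewrite mulrDl lerD // mul1r lef_pV2 ?posrE ?mulr_gt0 //.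
  by rewrite ler_piMl // ltW.
apply: (@le_trans _ _ (9 * (K / (X * y / m)) * X * ((a + 1) / (K * eps ^+ 2 * Num.sqrt X)))).
  apply: ler_pM => //; last first.
    by rewrite ler_wpM2l // !(mulr_ge0, invr_ge0, divr_ge0) // ltW.
  - by rewrite addr_ge0 ?invr_ge0 // ltW.
  - by rewrite !mulr_ge0 // ?invr_ge0 // ?divr_ge0 ?mulr_ge0 // ltW.
rewrite (_ : _ * _ = 9 * (a + 1) / (y * eps ^+ 2) * (m / Num.sqrt X)); last first.
  by field; rewrite !gt_eqF.
rewrite (_ : _ * c * _ = 9 * (a + 1) / (y * eps ^+ 2) * (c * y ^+ 2)); last first.
  by field; rewrite !gt_eqF.
by rewrite ler_wpM2l ?m_sqrtX_le // divr_ge0 ?mulr_ge0 ?addr_ge0 // ltW.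
Qed.

(** With threshold [eps * X / sm] the light sample is of order [sm / eps] and the heavy edges, all
    kept, of order [K * sm / eps]. *)
Lemma overflow_stored :
  overflow_bound (p_of (eps * X / sm)) 1 (Num.sqrt X)^-1 (eps * X / sm) e K
  <= load_factor * (K * eps^-1 * sm).
Proof.
have rho0 : 0 < eps * X / sm by rewrite divr_gt0 // mulr_gt0.
have s1 : (Num.sqrt X)^-1 <= 1.
  by rewrite invf_le1 // -sqrtr1 ler_wsqrtr.
rewrite /overflow_bound /load_factor [leRHS]mulrDl; apply: lerD.
  apply: (le_trans (mp_le rho0)); rewrite ler_wpM2l ?mulr_ge0 ?(ltW a0) //.
  rewrite -smm (_ : _ / _ = 1 * (eps^-1 * sm)); last by field; rewrite !gt_eqF.
  by rewrite -mulrA ler_wpM2r // mulr_ge0 ?invr_ge0 // ltW.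
apply: (@le_trans _ _ (9 * (K / (eps * X / sm)) * X * 2)).
  apply: ler_pM; last by lra.
  - by rewrite !mulr_ge0 // ?invr_ge0 ?divr_ge0 ?mulr_ge0 // ltW.
  - by rewrite addr_ge0 ?invr_ge0 // ltW.
  - by rewrite ler_wpM2l // !(mulr_ge0, invr_ge0, divr_ge0) // ltW.
rewrite (_ : _ * 2 = 9 * 2 * (K * eps^-1 * sm)); last by field; rewrite !gt_eqF.
rewrite ler_wpM2r ?mulr_ge0 ?invr_ge0 ?(ltW K0) ?(ltW eps0) ?(ltW sm0) //.
have a1 : 1 <= a by rewrite aE; have := exprn_ege1 2 c1; lra.
have a2 : 2 <= a + 1 by lra.
rewrite -mulrA ler_wpM2l // (le_trans a2) // ler_peMr //; lra.
Qed.
End Tuning.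

(** * Degenerate cases and assembly *)

Lemma unit_pmf (R : realType) : is_pmf (fun _ : unit => 1 : R).
Proof. by split=> [_|]; rewrite ?ler01 // big_const card_unit /= addr0. Qed.

Definition zero_alg (R : realType) (n : nat) : oracle_stream_alg R n :=
  OracleStreamAlg ltr01 (@unit_pmf R) tt (fun _ _ _ _ => tt) (fun=> 0).

Lemma prob_output_zero_alg (R : realType) n (D : labelling n -> R) s (good : pred R) :
  is_pmf D -> good 0 -> prob_output (zero_alg R n) D s good = 1.
Proof.
move=> [_ D1] g0; rewrite /prob_output -[RHS]D1; apply: eq_bigr => O _.
rewrite (eq_bigr (fun=> D O)) => [|r _]; last by rewrite big1 ?mulr1.
rewrite (eq_bigl predT) => [|r]; last exact: g0.
by rewrite sumr_const card_tuple card_unit exp1n.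
Qed.

Lemma target_space_ge0 (R : realType) (K eps : R) m T : 0 <= K -> 0 < eps ->
  0 <= target_space K eps m T.
Proof.
move=> K0 e0; have e0' := ltW e0.
have b0 : 0 <= K * eps^-1 * (m%:R : R) `^ (2%:R^-1).
  by rewrite !mulr_ge0 ?invr_ge0 ?powR_ge0.
rewrite /target_space; case: ifP => // _; rewrite le_min b0 andbT.
by rewrite mulr_ge0 ?invr_ge0 ?exprn_ge0 // divr_ge0 ?powR_ge0.
Qed.

(** The parameters use [X] for the unknown [T]; since [T <= X], this can only lower the first space
    bound. *)
Lemma cbrt_le (R : realType) (m T : nat) (X : R) : (0 < T)%N -> T%:R <= X ->
  let y := (m%:R ^+ 2 / X) `^ 3^-1 in
  y ^+ 3 = m%:R ^+ 2 / X /\ y <= m%:R `^ (2%:R / 3%:R) / T%:R `^ (3%:R^-1).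
Proof.
move=> T0 TX y; have T0' : 0 < T%:R :> R by rewrite ltr0n.
have X0 : 0 < X by exact: lt_le_trans TX.
have pw (z r : R) : 0 <= z -> (z `^ (r / 3)) ^+ 3 = z `^ r.
  by move=> z0; rewrite -powR_mulrn ?powR_ge0 // -powRrM divfK.
have y3 : y ^+ 3 = m%:R ^+ 2 / X.
  by rewrite /y -[3^-1]mul1r pw ?powRr1 // divr_ge0 ?sqr_ge0 // ltW.
split=> //; rewrite -(@ler_pXn2r _ 3) ?nnegrE ?powR_ge0 ?divr_ge0 ?powR_ge0 //.
rewrite y3 exprMn exprVn pw // -[3%:R^-1]mul1r pw // powRr1 // powR_mulrn //.
by rewrite ler_wpM2l ?sqr_ge0 // lef_pV2.
Qed.

(** The graph is quantified inside, so the algorithm can depend on it only through [n], [m] and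
    [Tapx]. *)
Definition meets_spec (R : realType) (c C K : R) n m (eps Tapx : R)
    (alg : oracle_stream_alg R n) : Prop :=
  forall e : rel 'I_n, symmetric e -> irreflexive e -> 0 < eps < 1 ->
  #|edges e| = m -> let T := #|triangles e| in
  c^-1 * T%:R <= Tapx <= c * T%:R ->
  space_words alg <= soft_bound C 0 (target_space K eps m T) /\
  forall s, adjacency_list_stream e s -> forall D, noisy_oracle e K (threshold alg) D ->
  2%:R / 3%:R <=
    prob_output alg D s (fun x : R => `|x - T%:R| <= Num.sqrt K * eps * T%:R).

(** The answer 0 is within the tolerance if there is no triangle, which either of the first two
    conditions forces, or if the relative error allowed is at least 1. *)
Lemma zero_alg_spec (R : realType) (c C K : R) n m (eps Tapx : R) :
  1 <= c -> 0 <= C -> 1 <= K ->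
  [|| c * Tapx < 1, m == 0%N | 1 <= K * eps ^+ 2] ->
  meets_spec c C K m eps Tapx (zero_alg R n).
Proof.
move=> c1 C0 K1 triv e e_sym e_irr /andP[e0 e1] mE T /andP[Tl Th].
have c0 : 0 < c by exact: lt_le_trans c1.
have K0 : 0 <= K by exact: le_trans K1.
split.
  rewrite /space_words card_unit ln1 mul0r /soft_bound expr0 mulr1.
  by rewrite mulr_ge0 // target_space_ge0.
move=> s _ D [Dpmf _]; rewrite prob_output_zero_alg //; first by lra.
rewrite sub0r normrN ger0_norm //.
case/or3P: triv => [x1|/eqP m0|Ke].
- have T1 : T%:R < 1 :> R by apply: le_lt_trans x1; rewrite mulrC -ler_pdivrMr // mulrC.
  by move: T1; rewrite ltrn1 ltnS leqn0 => /eqP ->; rewrite mulr0.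
- have := card_triangles_le e_sym e_irr; rewrite mE m0 leqn0 => /eqP T0.
  by rewrite /T T0 mulr0.
- rewrite ler_peMl // -(@expr_ge1 _ 2) ?mulr_ge0 ?(ltW e0) //.
  by rewrite exprMn sqr_sqrtr.
Qed.

(** [144 = 24 * 6]: a capacity of [W = 6 * load_factor * f] items costs at most [24 * W + 1] words,
    and [1 <= c * f] absorbs the last one. *)
Lemma alg_spec (R : realType) (c K : R) n m (eps Tapx : R) :
  1 <= c -> 1 <= K -> 1 <= c * Tapx -> (0 < m)%N -> 0 < eps -> K * eps ^+ 2 < 1 ->
  exists alg, meets_spec c (144 * load_factor c (78 * c ^+ 2) + c) K m eps Tapx (alg : oracle_stream_alg R n).
Proof.
move=> c1 K1 X1 m0 eps0 Keps.
have c0 : 0 < c by exact: lt_le_trans c1.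
have K0 : 0 < K by exact: lt_le_trans K1.
set a := 78 * c ^+ 2; set X := c * Tapx.
have a0 : 0 < a by rewrite mulr_gt0 // exprn_gt0.
have B0 : 0 < load_factor c a by rewrite /load_factor addr_gt0 // !mulr_gt0 // addr_gt0.
have X0 : 0 < X by exact: lt_le_trans X1.
have m0' : 0 < m%:R :> R by rewrite ltr0n.
pose y := (m%:R ^+ 2 / X) `^ 3^-1; pose sm : R := m%:R `^ 2^-1.
have y0 : 0 < y by rewrite powR_gt0 // divr_gt0 // exprn_gt0.
have sm0 : 0 < sm by rewrite powR_gt0.
have smm : sm * sm = m%:R by rewrite -expr2 /sm powR12_sqrt // sqr_sqrtr.
have e2 : 0 < eps ^+ 2 by rewrite exprn_gt0.
have sX : 0 < Num.sqrt X by rewrite sqrtr_gt0.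
have q'01 : 0 < (Num.sqrt X)^-1 <= 1.
  by rewrite invr_gt0 sX invf_le1 // -sqrtr1 ler_wsqrtr.
have graph (e : rel 'I_n) : #|edges e| = m ->
    c^-1 * #|triangles e|%:R <= Tapx <= c * #|triangles e|%:R ->
    [/\ #|triangles e|%:R <= X, X <= c ^+ 2 * #|triangles e|%:R
      & (0 < #|triangles e|)%N].
  move=> mE /andP[Tl Th].
  have XT : X <= c ^+ 2 * #|triangles e|%:R by rewrite expr2 -mulrA ler_wpM2l // ltW.
  split=> //; first by rewrite -ler_pdivrMl.
  rewrite lt0n; apply/eqP => T0; move: XT; rewrite T0 mulr0.
  by rewrite leNgt X0.
have space f W p q rho p01 q01 rho0 (e : rel 'I_n) : #|edges e| = m ->
    c^-1 * #|triangles e|%:R <= Tapx <= c * #|triangles e|%:R ->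
    0 < f -> W = 6 * (load_factor c a * f) -> 1 <= c * f ->
    f <= y / eps ^+ 2 -> f <= K * eps^-1 * sm ->
    space_words (@alg R n (Num.truncn W) p q (Num.sqrt X)^-1 rho p01 q01 q'01 rho0) <=
    soft_bound (144 * load_factor c a + c) 0 (target_space K eps m #|triangles e|).
  move=> mE apx f0 WE cf fy fK; have [TX XT T0] := graph e mE apx.
  have [_ yY] := cbrt_le m T0 TX.
  have W0 : 0 <= W by rewrite WE !mulr_ge0 // ltW.
  apply: (le_trans (space_words_alg n (Num.truncn W) p01 q01 q'01 rho0)).
  have /andP[WM _] := truncn_itv W0.
  apply: (@le_trans _ _ ((144 * load_factor c a + c) * f)).
    apply: (@le_trans _ _ (24 * W + c * f)); first by rewrite lerD // ler_wpM2l.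
    by rewrite WE le_eqVlt; apply/orP; left; apply/eqP; ring.
  rewrite /soft_bound expr0 mulr1 ler_wpM2l ?addr_ge0 ?mulr_ge0 ?(ltW B0) ?(ltW c0) //.
  rewrite /target_space (gtn_eqF T0) le_min fK andbT (le_trans fy) // mulrC.
  by rewrite ler_wpM2l // invr_ge0 ltW.
(* The smaller of the two bounds, with [X] for [T], decides between sampling the heavy edges and
   storing them all. *)
have [yK|Ky] := leP (y / eps ^+ 2) (K * eps^-1 * sm).
- pose rho := X * y / m%:R; pose q := Num.min 1 (a / (K * eps ^+ 2 * Num.sqrt X)).
  have rho0 : 0 < rho by rewrite divr_gt0 // mulr_gt0.
  have t0 : 0 < a / (K * eps ^+ 2 * Num.sqrt X) by rewrite divr_gt0 // !mulr_gt0.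
  have q01 : 0 < q <= 1 by exact: min1_itv.
  have p01 : 0 < p_of eps X a rho <= 1 by apply: min1_itv; rewrite divr_gt0 // mulr_gt0.
  pose W := 6 * (load_factor c a * (y / eps ^+ 2)).
  exists (alg n (Num.truncn W) p01 q01 q'01 rho0) => e e_sym e_irr /andP[_ e1] mE T apx.
  have [TX XT T0] := graph e mE apx; have [y3 _] := cbrt_le m T0 TX.
  have hy : 1 <= c * y.
    by apply: (y_ge e_sym e_irr c1 X1 XT y0); rewrite mE.
  split.
    apply: (space (y / eps ^+ 2)) => //; first by rewrite divr_gt0.
    rewrite mulrA (le_trans hy) // ler_peMr ?mulr_ge0 ?(ltW c0) ?(ltW y0) //.
    by rewrite invf_ge1 // expr_le1 // ltW.
  move=> s str D noisy; have {}noisy : noisy_oracle e K rho D := noisy.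
  apply: (alg_correct e_sym e_irr c1 K1 eps0 (erefl a) X1 TX XT _ _ _ _ _ _ _ str noisy).
  + by rewrite /q (le_trans (min1_inv t0)) // invf_div.
  + by rewrite /W !mulr_ge0 ?invr_ge0 // ltW.
  + rewrite (_ : W / 6 = load_factor c a * (y / eps ^+ 2)); last first.
      by rewrite /W [6 * _]mulrC mulfK.
    rewrite /rho -mE.
    apply: (overflow_sampled e_sym e_irr c1 K1 eps0 (ltW Keps) (erefl a) X1 TX XT y0).
    * by rewrite mE.
    * exact: sm0.
    * by rewrite mE.
    * by case/andP: q01.
    * by rewrite /q ge_min lexx orbT.
- pose rho := eps * X / sm.
  have rho0 : 0 < rho by rewrite divr_gt0 // mulr_gt0.
  have q01 : 0 < (1 : R) <= 1 by rewrite ltr01 lexx.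
  have p01 : 0 < p_of eps X a rho <= 1 by apply: min1_itv; rewrite divr_gt0 // mulr_gt0.
  have f0 : 0 < K * eps^-1 * sm by rewrite !mulr_gt0 // invr_gt0.
  pose W := 6 * (load_factor c a * (K * eps^-1 * sm)).
  exists (alg n (Num.truncn W) p01 q01 q'01 rho0) => e e_sym e_irr /andP[_ e1] mE T apx.
  have [TX XT T0] := graph e mE apx.
  split.
    apply: (space (K * eps^-1 * sm)) => //; last exact: ltW.
    have sm1 : 1 <= sm by rewrite -(@expr_ge1 _ 2) ?(ltW sm0) // expr2 smm ler1n.
    have ei : 1 <= eps^-1 by rewrite invf_ge1 // ltW.
    by rewrite !mulr_ege1.
  move=> s str D noisy; have {}noisy : noisy_oracle e K rho D := noisy.
  apply: (alg_correct e_sym e_irr c1 K1 eps0 (erefl a) X1 TX XT _ _ _ _ _ _ _ str noisy).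
  + by rewrite invr1 subrr divr_ge0 ?mulr_ge0 // ltW.
  + by rewrite /W !mulr_ge0 ?invr_ge0 // ltW.
  + rewrite (_ : W / 6 = load_factor c a * (K * eps^-1 * sm)); last first.
      by rewrite /W [6 * _]mulrC mulfK.
    by apply: (overflow_stored c1 K1 eps0 (erefl a) X1 TX sm0); rewrite mE.
Qed.

Theorem theorem1p4 (R : realType) (c : R) (hc : 1 <= c) :
  exists (C : R) (d : nat),
  forall K : R, 1 <= K ->
  exists A : (forall (n m : nat) (eps Tapx : R), oracle_stream_alg R n),
  forall (n : nat) (e : rel 'I_n) (eps Tapx : R),
    symmetric e -> irreflexive e ->
    0 < eps < 1 ->
    let m := #|edges e| in
    let T := #|triangles e| in
    c^-1 * T%:R <= Tapx <= c * T%:R ->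
    let alg := A n m eps Tapx in
    space_words alg <= soft_bound C d (target_space K eps m T) /\
    forall s : seq ('I_n * 'I_n), adjacency_list_stream e s ->
    forall D : labelling n -> R, noisy_oracle e K (threshold alg) D ->
      2%:R / 3%:R <=
        prob_output alg D s
          (fun x : R => `|x - T%:R| <= Num.sqrt K * eps * T%:R).
Proof.
have c0 : 0 <= c by exact: le_trans hc.
pose C : R := 144 * load_factor c (78 * c ^+ 2) + c.
have C0 : 0 <= C by rewrite /C /load_factor !(addr_ge0, mulr_ge0).
exists C, 0%N => K K1.
have H n m (eps Tapx : R) : exists alg : oracle_stream_alg R n,
    0 < eps -> meets_spec c C K m eps Tapx alg.
  have [triv|] := boolP [|| c * Tapx < 1, m == 0%N | 1 <= K * eps ^+ 2].
    by exists (zero_alg R n) => _; exact: zero_alg_spec.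
  rewrite !negb_or -leNgt -lt0n -ltNge => /and3P[X1 m0 Keps].
  have [eps0|_] := ltP 0 eps; last first.
    by exists (zero_alg R n).
  by have [alg algP] := alg_spec n hc K1 X1 m0 eps0 Keps; exists alg.
exists (fun n m eps Tapx => projT1 (cid (H n m eps Tapx))).
move=> n e eps Tapx e_sym e_irr eps01 m T apx alg; rewrite {}/alg.
case: cid => alg algP /=.
by apply: (algP _ e e_sym e_irr eps01 erefl apx); case/andP: eps01.
Qed.
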